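(* Let $X$ be an infinite-dimensional complex Banach space and $T\in L(X)$. Then: (i) $\sigma_{\mathbf{gK}\mathcal M}(T)$ is compact; (ii) the set $\sigma_{Kt}(T)\setminus\sigma_{\mathbf{gK}\mathcal M}(T)$ consists of at most countably many points.
   Context: $L(X)$ is the algebra of bounded linear operators on $X$; $N(T)$, $R(T)$ are kernel and range. $(M,N)\in Red(T)$ means that $M,N$ are closed $T$-invariant subspaces with $X=M\oplus N$; $T_M$, $T_N$ are the restrictions of $T$ viewed as operators on $M$, $N$. $T$ is Kato if $R(T)$ is closed and $N(T)\subset R(T^n)$ for every $n\in\mathbb N$. $T$ is of Kato type if there is $(M,N)\in Red(T)$ with $T_M$ Kato and $T_N$ nilpotent. An operator is meromorphic if every non-zero point of its spectrum is a pole of its resolvent. $T$ admits a generalized Kato-meromorphic decomposition if there is $(M,N)\in Red(T)$ with $T_M$ Kato and $T_N$ meromorphic. $\sigma_{Kt}(T)=\{\lambda\in\mathbb C:T-\lambda I\text{ is not of Kato type}\}$ and $\sigma_{\mathbf{gK}\mathcal M}(T)=\{\lambda\in\mathbb C:T-\lambda I\text{ does not admit a generalized Kato-meromorphic decomposition}\}$. *)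

(* Defs.v *)
From HB Require Import structures.
From mathcomp Require Import all_boot all_order all_algebra.
From mathcomp Require Import complex.
From mathcomp Require Import all_classical all_reals all_analysis.

Set Implicit Arguments.
Unset Strict Implicit.
Unset Printing Implicit Defensive.

Import Order.TTheory GRing.Theory Num.Theory numFieldNormedType.Exports.
Local Open Scope classical_set_scope.
Local Open Scope ring_scope.

Section ClosedSubspace.
Variables (K : numFieldType) (X : completeNormedModType K).

Record closed_subspace := ClosedSubspace {
  subspace_set :> set X;
  subspace_submod : submod_closed (mem subspace_set);
  subspace_closed : closed subspace_set }.

Definition subspace_pred (M : closed_subspace) : {pred X} :=
  [pred x | x \in (M : set X)].

Lemma subspace_pred_submod M : submod_closed (subspace_pred M).
Proof. exact: subspace_submod M. Qed.

HB.instance Definition _ (M : closed_subspace) :=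
  GRing.isSubmodClosed.Build K X (subspace_pred M)
    (GRing.submod_closed_semi (subspace_pred_submod M)).

(* A closed subspace as a Banach space in its own right.  [closed_subspace]
   also coerces, through [set X], to the library's [set_type], which carries
   no normed module structure; hence the separate type. *)
Definition subspace_type (M : closed_subspace) :=
  {x : X | x \in subspace_pred M}.

HB.instance Definition _ (M : closed_subspace) :=
  SubChoice.on (subspace_type M).
HB.instance Definition _ (M : closed_subspace) :=
  [SubChoice_isSubLmodule of subspace_type M by <:].

Section Norm.
Variable M : closed_subspace.

Definition subspace_norm (x : subspace_type M) : K := `|\val x|.

Lemma subspace_normD x y :
  subspace_norm (x + y) <= subspace_norm x + subspace_norm y.
Proof. by rewrite /subspace_norm raddfD ler_normD. Qed.

Lemma subspace_normZ (a : K) x :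
  subspace_norm (a *: x) = `|a| * subspace_norm x.
Proof. by rewrite /subspace_norm linearZ normrZ. Qed.

Lemma subspace_norm_eq0 x : subspace_norm x = 0 -> x = 0.
Proof.
by move=> /eqP; rewrite normr_eq0 => /eqP x0; apply: val_inj; rewrite x0 raddf0.
Qed.

HB.instance Definition _ := @Lmodule_isNormed.Build K (subspace_type M)
  subspace_norm subspace_normD subspace_normZ subspace_norm_eq0.

Lemma subspace_normE (x : subspace_type M) : `|x| = `|\val x|.
Proof. by []. Qed.

Lemma subspace_cauchy_cvg (F : set_system (subspace_type M)) :
  ProperFilter F -> cauchy F -> cvg F.
Proof.
move=> FF /cauchyP Fc.
have /cauchy_cvgP/cvg_ex[l Fl] : cauchy (\val @ F : set_system X).
  apply/cauchyP => e e0.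
  have [x Fx] := Fc e e0; exists (\val x).
  have Fy : \forall y \near F, ball (\val x) e (\val y).
    apply: filterS Fx => y; rewrite -!ball_normE /= => xy.
    by rewrite -(raddfB (\val : subspace_type M -> X)).
  exact: Fy.
have Ml : (M : set X) l.
  apply: (@closed_cvg _ _ F FF (\val : subspace_type M -> X) (M : set X)
           (@subspace_closed M) _ l Fl).
  by apply: nearW => y; apply: set_mem; exact: valP y.
have lM : l \in subspace_pred M by exact: mem_set Ml.
apply/cvg_ex; exists (Sub l lM : subspace_type M).
apply/cvgrPdist_lt => e e0.
move/cvgrPdist_lt : Fl => /(_ e e0).
by apply: filterS => y; rewrite subspace_normE raddfB.
Qed.

HB.instance Definition _ :=
  Uniform_isComplete.Build (subspace_type M) subspace_cauchy_cvg.

End Norm.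

Definition invariant (T : X -> X) (M : set X) : Prop :=
  forall x, M x -> M (T x).

Lemma restriction_subproof (M : closed_subspace) (T : X -> X)
    (TM : invariant T M) (x : subspace_type M) :
  T (\val x) \in subspace_pred M.
Proof. by apply/mem_set/TM/set_mem; exact: valP x. Qed.

Definition restriction (M : closed_subspace) (T : X -> X)
    (TM : invariant T M) (x : subspace_type M) : subspace_type M :=
  Sub (T (\val x)) (restriction_subproof TM x).

Definition direct_sum (M N : set X) : Prop :=
  M `&` N = [set 0] /\
  (forall x, exists y z, [/\ M y, N z & x = y + z]).

End ClosedSubspace.

(* The notions below are meant for K = R[i]. *)
Section Operators.
Variables (K : numFieldType) (X : completeNormedModType K).
Implicit Types (S T B : X -> X) (a : K).

Definition infinite_dimensional : Prop :=
  ~ exists (n : nat) (e : 'I_n -> X),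
      forall x, exists c : 'I_n -> K, x = \sum_(i < n) c i *: e i.

Definition bounded_operator T : Prop := linear T /\ continuous T.

Definition shift T a : X -> X := fun x => T x - a *: x.

Definition operator_inverse T B : Prop :=
  [/\ bounded_operator B, cancel T B & cancel B T].

Definition spectrum T : set K :=
  [set a | ~ exists B, operator_inverse (shift T a) B].

Definition kato T : Prop :=
  closed (range T) /\
  forall n : nat, [set x | T x = 0] `<=` range (iter n T).

Definition nilpotent T : Prop := exists n : nat, forall x, iter n T x = 0.

Definition operator_norm_cvg (F : nat -> X -> X) T : Prop :=
  forall e : K, 0 < e ->
    \forall n \near \oo, forall x, `|F n x - T x| <= e * `|x|.

(* Laurent expansion with finite principal part, of order d > 0:
   (T - z)^-1 = \sum_(k >= 0) (z - a)^(k - d) A_k with A_0 <> 0 on a punctured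
   disc about a, multiplied by (z - a)^d. *)
Definition resolvent_pole T a : Prop :=
  exists (d : nat) (A : nat -> X -> X) (r : K),
    [/\ (0 < d)%N, 0 < r, forall k, bounded_operator (A k),
        exists x, A 0%N x <> 0 &
        forall z, 0 < `|z - a| < r ->
          exists B, operator_inverse (shift T z) B /\
            operator_norm_cvg
              (fun n x => \sum_(k < n) (z - a) ^+ k *: A k x)
              (fun x => (z - a) ^+ d *: B x)].

Definition meromorphic T : Prop :=
  forall a, spectrum T a -> a <> 0 -> resolvent_pole T a.

End Operators.
Arguments infinite_dimensional {K} X.

Section Decompositions.
Variables (K : numFieldType) (X : completeNormedModType K).
Implicit Types T : X -> X.

Definition kato_type T : Prop :=
  exists (M N : closed_subspace X)
         (TM : invariant T M) (TN : invariant T N),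
    [/\ direct_sum M N, kato (restriction TM) & nilpotent (restriction TN)].

Definition gk_meromorphic T : Prop :=
  exists (M N : closed_subspace X)
         (TM : invariant T M) (TN : invariant T N),
    [/\ direct_sum M N, kato (restriction TM) & meromorphic (restriction TN)].

Definition kato_type_spectrum T : set K := [set a | ~ kato_type (shift T a)].

Definition gk_meromorphic_spectrum T : set K :=
  [set a | ~ gk_meromorphic (shift T a)].

End Decompositions.

(* Main.v *)
(** The key fact: if A = T - a admits a decomposition A = A_M + A_N with A_M Kato
    and A_N meromorphic, then A - c is of Kato type for all small c <> 0.

    On M one uses that A_M - c is Kato for small c: the hyperrange V of A_M is a
    closed subspace containing the kernel, A_M maps V onto V, and A_M is bounded
    below modulo V; all of this survives a small scalar perturbation.

    On N, c is a regular point or a pole of the resolvent.  Comparing Laurent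
    coefficients at a pole of order d shows, without contour integrals, that the
    coefficient B of exponent 0 commutes with Q = A_N - c and that
    Q^(d+1) B = Q^d; hence N is the direct sum of R(Q^d), where Q is invertible,
    and N(Q^d), where Q is nilpotent.  The range part is added to M.

    So the generalized spectrum has an open complement, and the difference of
    the two spectra consists of isolated points. *)
Require Import Defs.
From HB Require Import structures.
From mathcomp Require Import all_boot all_order all_algebra.
From mathcomp Require Import complex ring lra.
From mathcomp Require Import all_classical all_reals all_analysis.
Import Order.TTheory GRing.Theory Num.Theory numFieldNormedType.Exports.
Local Open Scope classical_set_scope.
Local Open Scope ring_scope.

Set Implicit Arguments.
Unset Strict Implicit.
Unset Printing Implicit Defensive.

Local Open Scope complex_scope.
Local Open Scope ring_scope.

(* These names are otherwise shadowed by library ones. *)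
Local Notation shift := Defs.shift.
Local Notation invariant := Defs.invariant.
Local Notation nilpotent := Defs.nilpotent.

(** * Real-valued norm, linearity and continuity *)

Section RealNorm.
Variable R : realType.

(* The norm of [Defs] takes values in [R[i]], whose order is partial; its real
   part makes it an element of the totally ordered field [R]. *)
Definition rnorm (V : normedZmodType R[i]) (x : V) : R := complex.Re `|x|.
Arguments rnorm {V} x.

Section Zmod.
Variable V : normedZmodType R[i].
Implicit Types x y : V.

Lemma norm_rnormE x : `|x| = (rnorm x)%:C.
Proof. by rewrite /rnorm RRe_real ?normr_real. Qed.

Lemma rnorm_ge0 x : 0 <= rnorm x.
Proof. by have := normr_ge0 x; rewrite norm_rnormE -[0]/(0%:C) lecR. Qed.

Lemma rnorm0 : rnorm (0 : V) = 0.
Proof. by rewrite /rnorm normr0. Qed.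

Lemma rnorm0_eq0 x : rnorm x = 0 -> x = 0.
Proof. by move=> x0; apply/normr0_eq0; rewrite norm_rnormE x0. Qed.

Lemma rnormD x y : rnorm (x + y) <= rnorm x + rnorm y.
Proof. by rewrite -lecR rmorphD /= -!norm_rnormE ler_normD. Qed.

Lemma rnormN x : rnorm (- x) = rnorm x.
Proof. by rewrite /rnorm normrN. Qed.

Lemma rnormBC x y : rnorm (x - y) = rnorm (y - x).
Proof. by rewrite -rnormN opprB. Qed.

Lemma rnormB x y : rnorm (x - y) <= rnorm x + rnorm y.
Proof. by rewrite -(rnormN y) rnormD. Qed.

Lemma rnorm_tri x y z : rnorm (x - z) <= rnorm (x - y) + rnorm (y - z).
Proof. by rewrite -(subrKA y x) rnormD. Qed.

Lemma rnorm_gt0 x : x <> 0 -> 0 < rnorm x.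
Proof.
move=> x0; rewrite lt_neqAle rnorm_ge0 andbT eq_sym.
by apply/eqP => /rnorm0_eq0.
Qed.

Lemma rnorm_small x : (forall e, 0 < e -> rnorm x <= e) -> x = 0.
Proof.
move=> small; apply/rnorm0_eq0/eqP; rewrite eq_le rnorm_ge0 andbT.
by apply/ler_addgt0Pr => e e0; rewrite add0r; exact: small.
Qed.

End Zmod.

Lemma rnormZ (V : normedModType R[i]) (a : R[i]) (x : V) :
  rnorm (a *: x) = rnorm a * rnorm x.
Proof.
by apply: complexI; rewrite rmorphM /= -!norm_rnormE normrZ.
Qed.

Lemma rnormM (a b : R[i]) : rnorm (a * b) = rnorm a * rnorm b.
Proof. by apply: complexI; rewrite rmorphM /= -!norm_rnormE normrM. Qed.

Lemma rnormX (a : R[i]) n : rnorm (a ^+ n) = rnorm a ^+ n.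
Proof. by apply: complexI; rewrite rmorphXn /= -!norm_rnormE normrX. Qed.

Lemma rnormV (a : R[i]) : rnorm a^-1 = (rnorm a)^-1.
Proof. by apply: complexI; rewrite fmorphV /= -!norm_rnormE normfV. Qed.

Lemma rnormR (r : R) : rnorm (r%:C : R[i]) = `|r|.
Proof.
by rewrite /rnorm normc_def /= expr0n addr0 sqrtr_sqr.
Qed.

Lemma gt0_complexE (e : R[i]) : 0 < e -> e = (complex.Re e)%:C /\ 0 < complex.Re e.
Proof.
move=> e0; have E : e = (complex.Re e)%:C by rewrite RRe_real // gtr0_real.
by split=> //; rewrite -ltcR -E.
Qed.

End RealNorm.
Arguments rnorm {R V} x.

Section Linear.
Variables (K : pzRingType) (V W : lmodType K).
Variables (T : V -> W) (T_lin : linear T).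

Lemma linear_D x y : T (x + y) = T x + T y.
Proof. by have := T_lin 1 x y; rewrite !scale1r. Qed.

Lemma linear_0 : T 0 = 0.
Proof. by apply: (addrI (T 0)); rewrite -linear_D !addr0. Qed.

Lemma linear_Z a x : T (a *: x) = a *: T x.
Proof. by have := T_lin a x 0; rewrite linear_0 !addr0. Qed.

Lemma linear_N x : T (- x) = - T x.
Proof. by rewrite -scaleN1r linear_Z scaleN1r. Qed.

Lemma linear_B x y : T (x - y) = T x - T y.
Proof. by rewrite linear_D linear_N. Qed.

Lemma linear_sum (f : nat -> V) n :
  T (\sum_(k < n) f k) = \sum_(k < n) T (f k).
Proof. by elim/big_ind2: _ => [|? ? ? ? <- <-|//]; rewrite ?linear_0 ?linear_D. Qed.

End Linear.

Section Topology.
Variables (R : realType) (V W : normedModType R[i]).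

Lemma closed_rnormP (A : set V) : closed A <->
  forall x, (forall e, 0 < e -> exists2 y, A y & rnorm (x - y) < e) -> A x.
Proof.
split=> [cA x Ax|cA x clAx].
  apply: cA => B /nbhs_ballP[e /= /gt0_complexE[-> e0] eB].
  have [y Ay xy] := Ax _ e0; exists y; split => //; apply: eB.
  by rewrite -ball_normE /= norm_rnormE ltcR.
apply: cA => e e0.
have [|y [Ay xy]] := clAx (ball x e%:C).
  by apply: nbhsx_ballx; rewrite ltcR.
by exists y => //; move: xy; rewrite -ball_normE /= norm_rnormE ltcR.
Qed.

Lemma linear_continuous_rnorm (T : V -> W) (T_lin : linear T) :
  continuous T <-> exists2 C, 0 <= C & forall x, rnorm (T x) <= C * rnorm x.
Proof.
split=> [cT|[C C0 CT] x].
  have /cvgrPdist_lt/(_ 1 ltr01) := cT 0.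
  move=> /nbhs_ballP[e /= /gt0_complexE[-> ]]; set d := complex.Re e => d0 dT.
  have d20 : 0 < d / 2 by rewrite divr_gt0.
  exists (2 / d) => [|x]; first by rewrite ltW // divr_gt0.
  have [->|/eqP x0] := eqVneq x 0; first by rewrite (linear_0 T_lin) !rnorm0 mulr0.
  have nx := rnorm_gt0 x0.
  (* Rescaled to norm d / 2, [x] enters a ball that [T] sends into the unit ball; hence the constant
     2 / d. *)
  have a0 : 0 < d / 2 / rnorm x by rewrite divr_gt0.
  have /dT : ball (0 : V) d%:C ((d / 2 / rnorm x)%:C *: x).
    rewrite -ball_normE /= sub0r normrN norm_rnormE ltcR rnormZ rnormR gtr0_norm //.
    by rewrite divfK ?gt_eqF // ltr_pdivrMr // ltr_pMr // ltr1n.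
  rewrite /= (linear_0 T_lin) sub0r normrN norm_rnormE -(rmorph1 (real_complex R)) ltcR (linear_Z T_lin) rnormZ rnormR gtr0_norm //.
  move=> /ltW; rewrite -ler_pdivlMl // => H.
  by apply: (le_trans H); rewrite mulr1 invf_div invf_div mulrC.
apply/cvgrPdist_lt => e /gt0_complexE[-> e0].
apply/nbhs_ballP; exists (complex.Re e / (C + 1))%:C => /= [|y].
  by rewrite ltcR divr_gt0 // ltr_wpDl.
rewrite -ball_normE /= !norm_rnormE !ltcR -(linear_B T_lin) ltr_pdivlMr ?ltr_wpDl // => xy.
apply: le_lt_trans (CT _) _; apply: le_lt_trans xy.
by rewrite mulrC ler_wpM2l ?rnorm_ge0 // lerDl.
Qed.

End Topology.

(** * The open mapping theorem *)

Section OpenMapping.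
Variable R : realType.

Lemma geometric_small (c e : R) : 0 < e -> exists k, c / 2 ^+ k < e.
Proof.
move=> e0; have [c0|c0] := leP c 0.
  by exists 0%N; rewrite expr0 divr1 (le_lt_trans c0).
exists (Num.Def.archi_bound (c / e)).
rewrite ltr_pdivrMr ?exprn_gt0 // mulrC -ltr_pdivrMr //.
apply: (@lt_le_trans _ _ (Num.Def.archi_bound (c / e))%:R).
  by rewrite archi_boundP // divr_ge0 // ltW.
by rewrite -natrX ler_nat ltnW // ltn_expl.
Qed.

Lemma geometric_le0 (c a : R) : (forall k, a <= c / 2 ^+ k) -> a <= 0.
Proof.
move=> ac; apply/ler_addgt0Pr => e e0; rewrite add0r.
by have [k /ltW] := geometric_small c e0; exact/le_trans/ac.
Qed.

(* Completeness of a source space given only by a set [D] and a size function,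
   so that it covers both closed subspaces and their products. *)
Definition geometric_complete (V : zmodType) (D : set V) (nV : V -> R) :=
  forall (x : nat -> V) c, (forall k, D (x k)) ->
    (forall k, nV (x k) <= c / 2 ^+ k) ->
  exists2 s, D s & forall k, nV (s - \sum_(i < k) x i) <= 2 * c / 2 ^+ k.

Lemma banach_geometric_complete (X : completeNormedModType R[i]) (D : set X) :
  closed D -> D 0 -> (forall x y, D x -> D y -> D (x + y)) ->
  geometric_complete D rnorm.
Proof.
move=> Dcl D0 DD x c Dx xc; pose s n := \sum_(i < n) x i.
have c0 : 0 <= c by have := xc 0%N; rewrite expr0 divr1; exact/le_trans/rnorm_ge0.
have Ds n : D (s n) by rewrite /s; elim/big_ind: _.
(* Keeping the exact value of the partial geometric sum lets the induction on [m] close. *)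
have tail k m : rnorm (s (k + m)%N - s k) <= 2 * c / 2 ^+ k - 2 * c / 2 ^+ (k + m).
  elim: m => [|m IH]; first by rewrite addn0 !subrr rnorm0.
  rewrite addnS /s big_ord_recr /= -/(s (k + m)%N) -addrA [x _ + _]addrC addrA.
  apply: le_trans (rnormD _ _) _; apply: le_trans (lerD IH (xc _)) _.
  rewrite exprS invfM; have := xc (k + m)%N; lra.
have tail' k n : (k <= n)%N -> rnorm (s n - s k) <= 2 * c / 2 ^+ k.
  move=> /subnKC <-; apply: le_trans (tail _ _) _.
  by rewrite gerBl divr_ge0 ?mulr_ge0 // exprn_ge0.
have /cauchy_cvgP/cvg_ex[l sl] : cauchy (s @ \oo).
  apply: cauchy_exP => e /gt0_complexE[-> e0].
  have [k ke] := geometric_small (2 * c) e0.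
  exists (s k); exists k => // n kn.
  by rewrite /= -ball_normE /= norm_rnormE ltcR rnormBC; exact: le_lt_trans (tail' _ _ kn) _.
have near_l e : 0 < e -> forall k, exists2 n, (k <= n)%N & rnorm (l - s n) < e.
  move=> e0 k; move/cvgrPdist_lt: sl => /(_ e%:C); rewrite ltcR => /(_ e0)[N _ Ns].
  exists (maxn k N); first exact: leq_maxl.
  by have := Ns (maxn k N) (leq_maxr _ _); rewrite /= norm_rnormE ltcR.
exists l.
  apply: ((closed_rnormP D).1 Dcl) => e e0.
  by have [n _ ln] := near_l e e0 0%N; exists (s n).
move=> k; apply/ler_addgt0Pl => e e0.
have [n kn ln] := near_l e e0 k.
by apply: le_trans (rnorm_tri _ (s n) _) _; rewrite lerD ?tail' // ltW.
Qed.

(** Successive correction: a lift leaving a residual of at most half the size is applied again to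
    that residual. The corrections decay like 2^-k and sum in [D] to an exact preimage, at the cost
    of doubling the constant. [W] is a set that retains the residuals; it will be an image, a
    closure, a hyperrange or the whole space. *)
Lemma approximate_lift (V : zmodType) (D : set V) (nV : V -> R)
    (Y : normedModType R[i]) (S : V -> Y) (W : set Y) (b C : R) :
  geometric_complete D nV -> {morph S : x y / x - y} -> 0 <= b ->
  (forall x, rnorm (S x) <= b * nV x) -> 0 <= C ->
  (forall y, W y -> exists x, [/\ D x, nV x <= C * rnorm y, W (y - S x)
     & rnorm (y - S x) <= rnorm y / 2]) ->
  forall y, W y -> exists x, [/\ D x, S x = y & nV x <= 2 * C * rnorm y].
Proof.
move=> cD SB b0 Sb C0 lift y Wy.
have /choice[f fP] : forall y, exists x, W y -> [/\ D x, nV x <= C * rnorm y,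
    W (y - S x) & rnorm (y - S x) <= rnorm y / 2].
  by move=> z; have [/lift[x]|nWz] := pselect (W z); [exists x|exists 0].
(* [r k] is the residual after k corrections, and [f (r k)] the next correction. *)
pose r k := iter k (fun z => z - S (f z)) y.
have Wr k : W (r k) by elim: k => //= k IH; have [] := fP _ IH.
have r_le k : rnorm (r k) <= rnorm y / 2 ^+ k.
  elim: k => [|k IH]; first by rewrite expr0 divr1.
  have [_ _ _] := fP _ (Wr k); rewrite exprS invfM => /le_trans; apply.
  by rewrite [2^-1 * _]mulrC mulrA ler_wpM2r // invr_ge0.
have [k|k|s Ds s_le] := cD (f \o r) (C * rnorm y).
- by have [] := fP _ (Wr k).
- have [_ fr _ _] := fP _ (Wr k); apply: le_trans fr _.
  by rewrite -mulrA ler_wpM2l.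
have S0 : S 0 = 0 by rewrite -(subrr 0) SB subrr.
have SN v : S (- v) = - S v by rewrite -sub0r SB S0 sub0r.
have SD u v : S (u + v) = S u + S v by rewrite -{1}[v]opprK SB SN opprK.
have Ssum k : S (\sum_(i < k) (f \o r) i) = y - r k.
  elim: k => [|k IH]; first by rewrite big_ord0 S0 subrr.
  by rewrite big_ord_recr /= SD IH /= opprB addrA [RHS]addrAC.
exists s; split => //; last first.
  by have := s_le 0%N; rewrite big_ord0 subr0 expr0 divr1 mulrA.
apply/subr0_eq/rnorm0_eq0/eqP; rewrite eq_le rnorm_ge0 andbT.
apply: (@geometric_le0 (b * (2 * (C * rnorm y)) + rnorm y)) => k.
have -> : S s - y = S (s - \sum_(i < k) (f \o r) i) - r k.
  by rewrite SB Ssum opprB addrA [RHS]addrAC addrK.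
apply: le_trans (rnormB _ _) _; rewrite mulrDl lerD //.
by apply: le_trans (Sb _) _; rewrite -mulrA ler_wpM2l.
Qed.

(** Baire's theorem relative to a closed set. If no [F n] were dense in a ball of [W], balls
    shrinking by a factor 4, each avoiding one more [F n], would converge to a point of [W] outside
    all of them. *)
Lemma baire_ball (X : completeNormedModType R[i]) (W : set X) (F : nat -> set X) :
  closed W -> W !=set0 -> W `<=` \bigcup_n F n ->
  exists n y (r : R), [/\ W y, 0 < r & forall z, W z -> rnorm (z - y) < r ->
    forall e : R, 0 < e -> exists2 f, F n f & rnorm (z - f) < e].
Proof.
move=> Wcl [w0 Ww0] WF; apply: contrapT => noball.
have step n (p : X * R) : exists q : X * R, W p.1 -> 0 < p.2 ->
    [/\ W q.1, rnorm (q.1 - p.1) < p.2, 0 < q.2, q.2 <= p.2 / 4 &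
      forall f, F n f -> 4 * q.2 <= rnorm (q.1 - f)].
  apply: contrapT => nostep; apply: noball; exists n, p.1, p.2.
  have [[Wp p0]|np] := pselect (W p.1 /\ 0 < p.2); last first.
    by exfalso; apply: nostep; exists p => ? ?; case: np.
  split => // z Wz zp e e0; apply: contrapT => far; apply: nostep.
  exists (z, Num.min p.2 e / 4) => _ _; split => //=.
  - by rewrite divr_gt0 // lt_min p0.
  - by rewrite ler_pM2r ?invr_gt0 // ge_min lexx.
  - move=> f Ff; rewrite mulrC divfK // ge_min orbC leNgt; apply/orP; left.
    by apply/negP => zf; apply: far; exists f.
pose g n := projT1 (choice (step n)).
have gP n := projT2 (choice (step n)).
pose p := fix p n := if n is m.+1 then g m (p m) else (w0, 1 : R).
have Wp n : W (p n).1 /\ 0 < (p n).2.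
  elim: n => [|n [IH1 IH2]] /=; first by split.
  by have [] := gP n (p n) IH1 IH2.
have pP n := gP n (p n) (Wp n).1 (Wp n).2.
have r_le k : (p k).2 <= 1 / 2 ^+ k.
  elim: k => [|k IH]; first by rewrite expr0 divr1.
  have [_ _ _ + _] := pP k; have [_ p0] := Wp k; rewrite exprS invfM /= => H.
  by move: IH H; lra.
have sumE k : \sum_(i < k) ((p i.+1).1 - (p i).1) = (p k).1 - w0.
  elim: k => [|k IH]; first by rewrite big_ord0 subrr.
  by rewrite big_ord_recr IH /= addrC addrA subrK.
have [//|k|s _ s_le] := @banach_geometric_complete X setT closedT I (fun _ _ _ _ => I)
    (fun k => (p k.+1).1 - (p k).1) 1.
  by have [_ /ltW near_p _ _ _] := pP k; exact: le_trans near_p (r_le k).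
pose l := s + w0.
have l_le k : rnorm (l - (p k).1) <= 2 / 2 ^+ k.
  by have := s_le k; rewrite sumE opprB addrA mulr1.
have Wl : W l.
  apply: ((closed_rnormP W).1 Wcl) => e e0; have [k ke] := geometric_small 2 e0.
  by exists (p k).1; [exact: (Wp k).1|exact: le_lt_trans (l_le k) ke].
(* The balls of radius [2 * (p n).2] are nested. The limit thus lies within twice the radius of each
   centre, while [F n] stays four radii away from centre n + 1. *)
have tail n m : rnorm ((p (n + m)%N).1 - (p n).1) + 2 * (p (n + m)%N).2 <= 2 * (p n).2.
  elim: m => [|m IH]; first by rewrite addn0 subrr rnorm0 add0r.
  rewrite addnS; have [_ near_p _ shrink _] := pP (n + m)%N.
  have := rnorm_tri (p (n + m).+1).1 (p (n + m)%N).1 (p n).1.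
  have := (Wp (n + m)%N).2; move: IH near_p shrink => /=; lra.
have [n _ Fnl] := WF _ Wl.
have [_ _ r0 _ /(_ _ Fnl) far] := pP n.
have : rnorm ((p n.+1).1 - l) <= 2 * (p n.+1).2.
  apply/ler_addgt0Pl => e e0; have [m me] := geometric_small 2 e0.
  have := rnorm_tri (p n.+1).1 (p (n.+1 + m)%N).1 l.
  rewrite [rnorm (_ - (p (n.+1 + m)%N).1)]rnormBC [rnorm ((p (n.+1 + m)%N).1 - l)]rnormBC.
  have := tail n.+1 m; have := l_le (n.+1 + m)%N; have := (Wp (n.+1 + m)%N).2.
  have : 2 / 2 ^+ (n.+1 + m) <= 2 / 2 ^+ m :> R.
    by rewrite ler_pM2l // lef_pV2 ?posrE ?exprn_gt0 // ler_weXn2l ?ler1n // leq_addl.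
  move: me; lra.
by move: far r0 => /=; lra.
Qed.

(** By Baire, the images of a bounded part of [D] are dense in some ball. Recentring this ball at 0
    and rescaling yields approximate lifts, which [approximate_lift] makes exact. *)
Lemma open_mapping (V : lmodType R[i]) (D : set V) (nV : V -> R)
    (Y : completeNormedModType R[i]) (S : V -> Y) (b : R) :
  geometric_complete D nV ->
  (forall a x, D x -> D (a *: x)) -> (forall x y, D x -> D y -> D (x - y)) ->
  (forall a x, nV (a *: x) = rnorm a * nV x) ->
  (forall x y, nV (x - y) <= nV x + nV y) -> (forall x, 0 <= nV x) ->
  D 0 -> linear S -> 0 <= b -> (forall x, rnorm (S x) <= b * nV x) ->
  closed (S @` D) ->
  exists2 C, 0 <= C & forall y, D y -> exists x, [/\ D x, S x = S y & nV x <= C * rnorm (S y)].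
Proof.
move=> cD DZ DB nZ nB n0 D0 Slin b0 Sb cl.
pose F n := S @` [set x | D x /\ nV x <= n%:R].
have [||n [_ [r [[y0 Dy0 <-] r0 dense]]]] := baire_ball (F := F) cl.
- by exists (S 0), 0.
- move=> _ [x Dx <-]; exists (Num.Def.archi_bound (nV x)) => //; exists x => //.
  by split=> //; rewrite ltW // archi_boundP.
(* [S x] is the difference of S (x + y0) and S y0, both approximable in the ball around S y0. The
   sum is written with a double negation because [D] is known to be stable under subtraction and
   scaling. *)
have approx0 x : D x -> rnorm (S x) < r -> forall e, 0 < e ->
    exists u, [/\ D u, nV u <= 2 * n%:R & rnorm (S x - S u) < e].
  move=> Dx xr e e0; have e20 : 0 < e / 2 by rewrite divr_gt0.
  have [||_ [u1 [Du1 u1n] <-] u1e] := dense (S (x - (- 1) *: y0)) _ _ _ e20.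
  - by exists (x - (- 1) *: y0) => //; apply/DB/DZ.
  - by rewrite scaleN1r opprK (linear_D Slin) // addrK.
  have [||_ [u0 [Du0 u0n] <-] u0e] := dense (S y0) _ _ _ e20.
  - by exists y0.
  - by rewrite subrr rnorm0.
  exists (u1 - u0); split; first exact: DB.
    by apply: le_trans (nB _ _) _; rewrite mulr_natl mulr2n lerD.
  have -> : S x - S (u1 - u0) =
     (S (x - (- 1) *: y0) - S u1) - (S y0 - S u0).
    rewrite scaleN1r opprK (linear_B Slin) (linear_D Slin) !opprB.
    by rewrite [S x + S y0 - _]addrAC -[RHS]addrA [S y0 + _]addrC subrK addrA addrAC.
  by apply: le_lt_trans (rnormB _ _) _; rewrite (splitr e) ltrD.
have lift y : (S @` D) y -> exists x, [/\ D x, nV x <= 4 * n%:R / r * rnorm y,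
    (S @` D) (y - S x) & rnorm (y - S x) <= rnorm y / 2].
  move=> [x Dx <-]; have [->|/eqP y0_] := eqVneq (S x) 0.
    exists 0; rewrite (linear_0 Slin) // subrr rnorm0 mulr0 mul0r; split => //; last by exists 0; rewrite ?(linear_0 Slin).
    by rewrite -(scale0r 0) nZ rnorm0 mul0r.
  (* With this [a], the image of a x has norm r / 2 < r, and an error of r / 4 divided by [a] is
     half of |S x|. *)
  have ny := rnorm_gt0 y0_; pose a := r / 2 / rnorm (S x).
  have a0 : 0 < a by rewrite !divr_gt0.
  have r40 : 0 < r / 4 by rewrite divr_gt0.
  have [||u [Du un ue]] := approx0 (a%:C *: x) _ _ _ r40; first exact: DZ.
    rewrite (linear_Z Slin) // rnormZ rnormR gtr0_norm // /a divfK ?gt_eqF //.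
    by rewrite ltr_pdivrMr // ltr_pMr // ltr1n.
  have aC : a%:C != 0 by rewrite -(rmorph0 (real_complex R)) (inj_eq (@complexI _)) gt_eqF.
  exists (a%:C^-1 *: u); have uD : D (a%:C^-1 *: u) by exact: DZ.
  have na : rnorm (a%:C^-1 : R[i]) = 2 * rnorm (S x) / r.
    by rewrite rnormV rnormR gtr0_norm // /a; field; rewrite !gt_eqF.
  split => //.
  - rewrite nZ na; apply: le_trans (ler_wpM2l _ un) _.
      by rewrite !mulr_ge0 ?rnorm_ge0 // invr_ge0 ltW.
    by rewrite le_eqVlt; apply/predU1l; field; rewrite gt_eqF.
  - by exists (x - a%:C^-1 *: u); [exact: DB|rewrite (linear_B Slin)].
  - have -> : S x - S (a%:C^-1 *: u) = a%:C^-1 *: (S (a%:C *: x) - S u).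
      by rewrite !(linear_Z Slin) // scalerBr scalerA mulVf // scale1r.
    rewrite rnormZ na; apply: le_trans (ler_wpM2l _ (ltW ue)) _.
      by rewrite !mulr_ge0 ?rnorm_ge0 // invr_ge0 ltW.
    by rewrite le_eqVlt; apply/predU1l; field; rewrite gt_eqF.
have C0 : 0 <= 4 * n%:R / r by rewrite divr_ge0 ?mulr_ge0 // ltW.
exists (2 * (4 * n%:R / r)); first by rewrite mulr_ge0.
move=> y Dy; apply: (approximate_lift cD _ b0 Sb C0 lift); last by exists y.
by move=> ? ?; rewrite (linear_B Slin).
Qed.

End OpenMapping.

(** * Kato operators and their perturbation by scalars *)

Section Kato.
Variable R : realType.

Lemma linear_iter (K : pzRingType) (V : lmodType K) (T : V -> V) n :
  linear T -> linear (iter n T).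
Proof. by move=> Tl; elim: n => [|n IH] a x y //=; rewrite IH Tl. Qed.

Lemma bounded_iter (V : normedModType R[i]) (T : V -> V) (b : R) n : 0 <= b ->
  (forall x, rnorm (T x) <= b * rnorm x) ->
  forall x, rnorm (iter n T x) <= b ^+ n * rnorm x.
Proof.
move=> b0 Tb x; elim: n => [|n IH]; first by rewrite mul1r.
by apply: le_trans (Tb _) _; rewrite exprS -mulrA ler_wpM2l.
Qed.

Lemma linear_shift (K : numFieldType) (V : completeNormedModType K) (T : V -> V) a :
  linear T -> linear (shift T a).
Proof.
move=> Tl c x y; rewrite /shift (linear_D Tl) (linear_Z Tl) scalerDr opprD addrACA.
by rewrite scalerBr !scalerA mulrC.
Qed.

(* For closed [D] this is equivalent to [T @` D] being closed, and unlike the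
   latter it passes easily to direct sums and perturbations. *)
Definition liftable (V W : normedModType R[i]) (T : V -> W) (D : set V) :=
  exists2 C : R, 0 <= C & forall y, D y ->
    exists x, [/\ D x, T x = T y & rnorm x <= C * rnorm (T y)].

Definition is_subspace (K : pzRingType) (V : lmodType K) (D : set V) :=
  [/\ D 0, forall x y, D x -> D y -> D (x + y) & forall a x, D x -> D (a *: x)].

Lemma is_subspaceB (K : pzRingType) (V : lmodType K) (D : set V) x y :
  is_subspace D -> D x -> D y -> D (x - y).
Proof. by case=> _ DD DZ Dx Dy; rewrite -scaleN1r; apply/DD/DZ. Qed.

Lemma closed_subspaceP (K : numFieldType) (X : completeNormedModType K)
  (M : closed_subspace X) : is_subspace (M : set X).
Proof.
have [M0 ML] := subspace_submod M.
have MDZ a x y : (M : set X) x -> (M : set X) y -> (M : set X) (a *: x + y).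
  by move=> Mx My; apply/set_mem/ML; exact/mem_set.
have M0' : (M : set X) 0 by exact/set_mem.
split=> // [x y Mx My|a x Mx]; first by rewrite -[x]scale1r; exact: MDZ.
by rewrite -[_ *: _]addr0; exact: MDZ.
Qed.

Lemma subspace_submod_closed (K : pzRingType) (V : lmodType K) (D : set V) :
  is_subspace D -> submod_closed (mem D).
Proof.
case=> D0 DD DZ; split=> [|a x y Dx Dy]; first exact/mem_set.
by apply/mem_set/DD; [apply/DZ|]; exact/set_mem.
Qed.

Section Lift.
Variables (X Y : completeNormedModType R[i]) (T : X -> Y) (D : set X).
Hypotheses (T_lin : linear T) (T_cont : continuous T).
Hypotheses (D_sub : is_subspace D) (D_closed : closed D).

Lemma subspace_geometric_complete : geometric_complete D rnorm.
Proof. by case: D_sub => ? ? ?; exact: banach_geometric_complete. Qed.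

Lemma liftable_closed_image : liftable T D -> closed (T @` D).
Proof.
case: (D_sub) => D0 DD DZ [C C0 lift]; have TB := linear_B T_lin.
have [b b0 Tb] := (linear_continuous_rnorm T_lin).1 T_cont.
apply/closed_rnormP.
pose W y := forall e : R, 0 < e -> exists2 z, (T @` D) z & rnorm (y - z) < e.
have C20 : 0 <= 2 * C by rewrite mulr_ge0.
(* An image T x0 within |y| / 2 of y has norm at most 3 |y| / 2, so its bounded lift has norm at
   most 2 C |y|. *)
have approx y : W y -> exists x, [/\ D x, rnorm x <= 2 * C * rnorm y, W (y - T x)
     & rnorm (y - T x) <= rnorm y / 2].
  move=> Wy; have [y0|/eqP/rnorm_gt0 ny] := eqVneq y 0.
    by exists 0; rewrite (linear_0 T_lin) subr0 y0 !rnorm0 mulr0 mul0r -y0.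
  have ny2 : 0 < rnorm y / 2 by rewrite divr_gt0.
  have [_ [x0 Dx0 <-] yx0] := Wy _ ny2.
  have [x [Dx Tx xle]] := lift _ Dx0; exists x; rewrite Tx; split => //.
  - apply: le_trans xle _; rewrite -mulrA mulrCA ler_wpM2l //.
    have := rnorm_tri (T x0) y 0; rewrite !subr0 rnormBC; move: yx0 ny; lra.
  - move=> e /Wy[_ [z Dz <-] yz]; exists (T (z - x0)).
      by exists (z - x0) => //; exact: is_subspaceB.
    by rewrite TB opprB addrA subrK.
  - exact: ltW.
move=> y Wy.
have [|x [Dx Tx _]] := approximate_lift subspace_geometric_complete _ b0 Tb C20 approx Wy.
  by move=> ? ?; rewrite TB.
by exists x.
Qed.

Lemma closed_image_liftable : closed (T @` D) -> liftable T D.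
Proof.
case: (D_sub) => D0 DD DZ clTD.
have [b b0 Tb] := (linear_continuous_rnorm T_lin).1 T_cont.
apply: open_mapping subspace_geometric_complete _ _ _ _ _ _ T_lin b0 Tb clTD => //.
- by move=> x y Dx Dy; exact: is_subspaceB.
- by move=> a x; rewrite rnormZ.
- exact: rnormB.
- exact: rnorm_ge0.
Qed.

End Lift.

Lemma is_subspaceT (K : pzRingType) (V : lmodType K) : is_subspace [set: V].
Proof. by []. Qed.

(** The Kato property of the restriction to [M], stated inside [X] so that estimates avoid the
    subspace type; [kato_restriction] translates. *)
Definition kato_on (X : normedModType R[i]) (T : X -> X) (M : set X) :=
  liftable T M /\
  forall n x, M x -> T x = 0 -> exists2 y, M y & iter n T y = x.

Lemma kato_onT (X : completeNormedModType R[i]) (T : X -> X) :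
  bounded_operator T -> kato T <-> kato_on T setT.
Proof.
move=> [Tl Tc]; split=> -[Trange Tker]; split.
- exact: closed_image_liftable (@is_subspaceT _ _) closedT Trange.
- by move=> n x _ /(Tker n).
- exact: liftable_closed_image (@is_subspaceT _ _) closedT Trange.
- by move=> n x /= /(Tker n x I)[y _ <-]; exists y.
Qed.

Section Restriction.
Variables (X : completeNormedModType R[i]) (M : closed_subspace X).
Variables (T : X -> X) (TM : invariant T M).
Hypothesis T_bounded : bounded_operator T.

Lemma subspace_valP (x : subspace_type M) : (M : set X) (val x).
Proof. exact/set_mem/(valP x). Qed.

Lemma subspace_lift x : (M : set X) x -> exists u : subspace_type M, val u = x.
Proof. by move=> Mx; exists (Sub x (mem_set Mx)); rewrite SubK. Qed.

Lemma rnorm_val (x : subspace_type M) : rnorm (val x) = rnorm x.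
Proof. by []. Qed.

Lemma val_restriction (x : subspace_type M) : val (restriction TM x) = T (val x).
Proof. by rewrite SubK. Qed.

Lemma val_iter_restriction n (x : subspace_type M) :
  val (iter n (restriction TM) x) = iter n T (val x).
Proof. by elim: n => // n IH; rewrite !iterS val_restriction IH. Qed.

Lemma restriction_bounded : bounded_operator (restriction TM).
Proof.
case: T_bounded => Tl Tc; have Tr : linear (restriction TM).
  by move=> a x y; apply: val_inj; rewrite linearP !val_restriction -Tl linearP.
split=> //; apply/(linear_continuous_rnorm Tr).
have [b b0 Tb] := (linear_continuous_rnorm Tl).1 Tc.
by exists b => // x; rewrite -!rnorm_val val_restriction.
Qed.

Lemma kato_restriction : kato (restriction TM) <-> kato_on T M.
Proof.
apply: iff_trans (kato_onT restriction_bounded) _.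
split=> -[[C C0 lift] ker]; split.
- exists C => // y /subspace_lift[v <-].
  have [u [_ Tu ule]] := lift v I; exists (val u).
  by rewrite -!val_restriction Tu rnorm_val; split=> //; exact: subspace_valP.
- move=> n x /subspace_lift[v <-]; rewrite -val_restriction => Tv.
  have [|y _ <-] := ker n v I; first by apply: val_inj; rewrite Tv raddf0.
  by exists (val y); [exact: subspace_valP|rewrite val_iter_restriction].
- exists C => // v _; have [x [/subspace_lift[u <-] Tu ule]] := lift _ (subspace_valP v).
  by exists u; rewrite -!rnorm_val val_restriction; split => //; apply: val_inj; rewrite !val_restriction.
- move=> n v _ Tv; have [|_ /subspace_lift[u <-] uv] := ker n _ (subspace_valP v).
    by rewrite -val_restriction Tv raddf0.
  by exists u => //; apply: val_inj; rewrite val_iter_restriction.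
Qed.

End Restriction.

Section Perturbation.
Variables (X : completeNormedModType R[i]) (T : X -> X).
Hypotheses (T_bounded : bounded_operator T) (T_kato : kato_on T setT).

Definition hyperrange := [set x : X | forall n, exists y, iter n T y = x].

Let T_lin : linear T. Proof. by case: T_bounded. Qed.
Let iter_lin n : linear (iter n T). Proof. exact: linear_iter. Qed.

Lemma hyperrange_kernel x : T x = 0 -> hyperrange x.
Proof. by move=> Tx n; have [y _ <-] := T_kato.2 n x I Tx; exists y. Qed.

(** If T x = T^(n+1) y, then x - T^n y is in the kernel, hence in the hyperrange. Consequently [T]
    maps the hyperrange onto itself. *)
Lemma hyperrange_preimage x : hyperrange (T x) -> hyperrange x.
Proof.
move=> Vx n; have [y /= yx] := Vx n.+1.
have [|z zx] := @hyperrange_kernel (x - iter n T y) _ n.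
  by rewrite (linear_B T_lin) yx subrr.
by exists (z + y); rewrite (linear_D (iter_lin n)) zx subrK.
Qed.

Lemma hyperrange_subspace : is_subspace hyperrange.
Proof.
split=> [n|x y Vx Vy n|a x Vx n].
- by exists 0; exact: (linear_0 (iter_lin n)).
- have [[u <-] [v <-]] := (Vx n, Vy n); exists (u + v).
  by rewrite (linear_D (iter_lin n)).
- by have [u <-] := Vx n; exists (a *: u); rewrite (linear_Z (iter_lin n)).
Qed.

(** The hyperrange is the intersection of the ranges of the powers of [T], each closed because lifts
    compose, with constant C^n. *)
Lemma hyperrange_closed : closed hyperrange.
Proof.
have [[C C0 lift] _] := T_kato.
have lift_iter n y : (exists z, iter n T z = y) ->
    exists2 x, iter n T x = y & rnorm x <= C ^+ n * rnorm y.
  elim: n y => [|n IH] y [z zy]; first by exists y => //; rewrite mul1r.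
  (* The lift [x1] differs from T^n z by a kernel vector, which lies in R(T^n); so [x1] can in turn
     be lifted through T^n. *)
  have [x1 [_ Tx1 x1le]] := lift (iter n T z) I.
  have [|x2 x2x1 x2le] := IH x1.
    have [|u ux] := @hyperrange_kernel (x1 - iter n T z) _ n.
      by rewrite (linear_B T_lin) Tx1 subrr.
    by exists (u + z); rewrite (linear_D (iter_lin n)) ux subrK.
  exists x2; first by rewrite /= x2x1 Tx1.
  apply: le_trans x2le _; rewrite exprSr -mulrA ler_wpM2l ?exprn_ge0 //.
  by rewrite -zy.
apply/closed_rnormP => x Vx n.
have cl : closed (iter n T @` setT).
  have [b b0 Tb] := (linear_continuous_rnorm T_lin).1 T_bounded.2.
  apply: liftable_closed_image => //.
    apply/(linear_continuous_rnorm (iter_lin n)).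
    by exists (b ^+ n); [exact: exprn_ge0|exact: bounded_iter].
  exists (C ^+ n); first exact: exprn_ge0.
  by move=> y _; have [|z ? ?] := lift_iter n (iter n T y); [exists y|exists z].
have [|y _ <-] := (closed_rnormP _).1 cl x; last by exists y.
by move=> e /Vx[z Vz xz]; exists z => //; have [y <-] := Vz n; exists y.
Qed.

(** Let V be the hyperrange and S = T - l. Bounded lifts inside V persist for S, the kernel of S
    lies in V, and S x controls the distance from x to V. The first two facts give the kernel
    inclusion; the first and third give liftability. *)
Lemma kato_shift : exists2 e : R, 0 < e &
  forall l, rnorm l < e -> kato_on (shift T l) setT.
Proof.
have [[C0 C00 lift0] _] := T_kato; pose C := C0 + 1.
have C0_gt : 0 < C by rewrite ltr_wpDl.
have lift y : exists2 x, T x = T y & rnorm x <= C * rnorm (T y).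
  have [x [_ Tx xle]] := lift0 y I; exists x => //; apply: le_trans xle _.
  by rewrite ler_wpM2r ?rnorm_ge0 // lerDl.
have [V0 VD VZ] := hyperrange_subspace.
have VB x y : hyperrange x -> hyperrange y -> hyperrange (x - y).
  by apply: is_subspaceB; exact: hyperrange_subspace.
(* Lifting y through [T] instead of S leaves the residual l x, of norm at most |l| C |y|, which must
   not exceed |y| / 2. *)
exists (1 / (2 * C)) => [|l]; first by rewrite divr_gt0 ?mulr_gt0.
rewrite ltr_pdivlMr ?mulr_gt0 // => lC.
have lC' : rnorm l * C <= 1 / 2 by move: lC; lra.
pose S := shift T l; have S_lin : linear S by exact: linear_shift.
have [b0 b0_ge Tb] := (linear_continuous_rnorm T_lin).1 T_bounded.2.
pose b := b0 + rnorm l; have b_ge : 0 <= b by rewrite addr_ge0 ?rnorm_ge0.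
have Sb x : rnorm (S x) <= b * rnorm x.
  by apply: le_trans (rnormB _ _) _; rewrite rnormZ mulrDl lerD.
have liftV y : hyperrange y ->
    exists x, [/\ hyperrange x, S x = y & rnorm x <= 2 * C * rnorm y].
  apply: (approximate_lift _ _ b_ge Sb (ltW C0_gt)).
  - exact: subspace_geometric_complete hyperrange_subspace hyperrange_closed.
  - exact: linear_B.
  move=> {}y Vy; have [z /= zy] := Vy 1%N; have [x] := lift z; rewrite zy => Tx xle.
  have Vx : hyperrange x by apply: hyperrange_preimage; rewrite Tx.
  exists x; have -> : y - S x = l *: x by rewrite /S /shift Tx opprB addrC subrK.
  split; [by []|by []|exact: VZ|].
  rewrite rnormZ; apply: le_trans (ler_wpM2l (rnorm_ge0 _) xle) _.
  by rewrite mulrA mulrC ler_wpM2l ?rnorm_ge0 // -[2^-1]mul1r.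
split; last first.
  (* For nonzero l, x = T^m (l^-m x) for all m, so x is in the hyperrange, where preimages under S
     can be iterated. *)
  move=> n x _ Sx; have Vx : hyperrange x.
    have Tx : T x = l *: x by apply/subr0_eq.
    have [l0|l0] := eqVneq l 0.
      by apply: hyperrange_kernel; rewrite Tx l0 scale0r.
    move=> m; exists (l ^- m *: x); rewrite (linear_Z (iter_lin m)).
    have -> : iter m T x = l ^+ m *: x.
      elim: m => [|m /= ->]; first by rewrite scale1r.
      by rewrite (linear_Z T_lin) Tx scalerA exprSr.
    by rewrite scalerA mulVf ?scale1r // expf_neq0.
  elim: n x Vx {Sx} => [|n IH] x Vx; first by exists x.
  have [u [/IH[y _ <-] <- _]] := liftV x Vx; by exists y.
(* With T u = v and [w] a short preimage of T x - v, both u and x - u - w lie in the hyperrange,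
   hence so does x - w. *)
have near_V x v : hyperrange v ->
    exists2 v', hyperrange v' & rnorm (x - v') <= C * rnorm (T x - v).
  move=> Vv; have [u /= uv] := Vv 1%N; have [w Tw wle] := lift (x - u).
  move: Tw wle; rewrite (linear_B T_lin) uv => Tw wle.
  exists (x - w); last by rewrite opprB addrC subrK.
  have -> : x - w = u + (x - u - w) by rewrite addrA [u + _]addrC subrK.
  apply: VD; first by apply: hyperrange_preimage; rewrite uv.
  by apply: hyperrange_kernel; rewrite !(linear_B T_lin) uv Tw subrr.
(* The distance a from x to the hyperrange satisfies a <= C (|l| a + |S x|)
   with |l| C <= 1/2; iterating replaces the infimum. *)
have approach x k : exists2 v, hyperrange v &
    rnorm (x - v) <= rnorm x / 2 ^+ k + 2 * C * rnorm (S x).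
  elim: k => [|k [v Vv vle]].
    exists 0 => //; rewrite subr0 expr0 divr1 lerDl.
    by rewrite !mulr_ge0 ?rnorm_ge0 // ltW.
  have [v' Vv' v'le] := near_V x _ (VZ l _ Vv); exists v' => //.
  apply: le_trans v'le _.
  have -> : T x - l *: v = S x + l *: (x - v).
    by rewrite scalerBr addrA subrK.
  have := rnormD (S x) (l *: (x - v)); rewrite rnormZ.
  rewrite -(ler_pM2l C0_gt) => /le_trans; apply.
  have := ler_wpM2r (rnorm_ge0 (x - v)) lC'; rewrite exprS invfM.
  move: vle; set p := rnorm x; set q := rnorm (S x); set r := rnorm (x - v); lra.
(* 3 C accounts for x - v. Since S v = S x - S (x - v) has norm at most (1 + 3 C b) |S x|, lifting
   it in the hyperrange adds the factor 2 C. *)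
pose C2 := 3 * C + 2 * C * (1 + 3 * C * b).
have C20 : 0 <= C2 by rewrite addr_ge0 ?mulr_ge0 ?addr_ge0 ?mulr_ge0 // ltW.
(* Making |x| / 2^k smaller than C |S x| requires S x to be nonzero; otherwise 0 is the lift. *)
exists C2 => // x _; have [Sx0|/eqP/rnorm_gt0 nS] := eqVneq (S x) 0.
  by exists 0; rewrite -/S Sx0 (linear_0 S_lin) !rnorm0 mulr0.
have CS : 0 < C * rnorm (S x) by rewrite mulr_gt0.
have [k xk] := geometric_small (rnorm x) CS.
have [v Vv vle] := approach x k.
have {}vle : rnorm (x - v) <= 3 * C * rnorm (S x) by move: vle xk; lra.
have VS : hyperrange (S v).
  apply: VB; last exact: VZ.
  by move=> n; have [y <-] := Vv n; exists (T y); rewrite -iterSr.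
have [v' [_ Sv' v'le]] := liftV _ VS.
have Sv : rnorm (S v) <= rnorm (S x) + 3 * C * b * rnorm (S x).
  have -> : S v = S x - S (x - v) by rewrite (linear_B S_lin) opprB addrC subrK.
  apply: le_trans (rnormB _ _) _; rewrite lerD2l; apply: le_trans (Sb _) _.
  apply: le_trans (ler_wpM2l b_ge vle) _.
  by rewrite mulrA [b * _]mulrC.
exists (x - v + v'); split => //.
  by rewrite -/S (linear_D S_lin) (linear_B S_lin) Sv' subrK.
apply: le_trans (rnormD _ _) _; rewrite -/S mulrDl lerD //.
apply: le_trans v'le _; rewrite -[leRHS]mulrA ler_wpM2l ?mulr_ge0 ?(ltW C0_gt) //.
by rewrite mulrDl mul1r.
Qed.

End Perturbation.
End Kato.

(** * Poles of the resolvent *)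

Section Pole.
Variable R : realType.

Section NullSequences.
Variable V : normedModType R[i].
Implicit Types u v : nat -> V.

Definition null_sequence u := forall e : R, 0 < e ->
  exists N, forall n, (N <= n)%N -> rnorm (u n) <= e.

Lemma null_sequenceB u v : null_sequence u -> null_sequence v ->
  null_sequence (fun n => u n - v n).
Proof.
move=> u0 v0 e e0; have e20 : 0 < e / 2 by rewrite divr_gt0.
have [[N Nu] [M Mv]] := (u0 _ e20, v0 _ e20).
exists (maxn N M) => n; rewrite geq_max => /andP[/Nu un /Mv vn].
by apply: le_trans (rnormB _ _) _; rewrite (splitr e) lerD.
Qed.

Lemma null_sequence_bounded u (T : V -> V) (b : R) : 0 <= b ->
  (forall x, rnorm (T x) <= b * rnorm x) ->
  null_sequence u -> null_sequence (fun n => T (u n)).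
Proof.
move=> b0 Tb u0 e e0; have b1 : 0 < b + 1 by rewrite ltr_wpDl.
have [|N Nu] := u0 (e / (b + 1)); first by rewrite divr_gt0.
exists N => n /Nu; rewrite ler_pdivlMr // => un.
apply: le_trans (Tb _) _; apply: le_trans un.
by rewrite mulrC ler_wpM2l ?rnorm_ge0 // lerDl.
Qed.

Lemma null_sequenceZ u a : null_sequence u -> null_sequence (fun n => a *: u n).
Proof.
by apply: (null_sequence_bounded (rnorm_ge0 a)) => x; rewrite rnormZ.
Qed.

Lemma null_sequenceS u : null_sequence (fun n => u n.+1) <-> null_sequence u.
Proof.
split=> u0 e /u0[N Nu]; last by exists N => n Nn; exact/Nu/leqW.
by exists N.+1 => -[//|n]; exact: Nu.
Qed.

Lemma null_sequence_eq u v N : (forall n, (N <= n)%N -> u n = v n) ->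
  null_sequence u -> null_sequence v.
Proof.
move=> uv u0 e /u0[M Mu]; exists (maxn N M) => n.
by rewrite geq_max => /andP[/uv <-]; exact: Mu.
Qed.

Lemma eventually_bounded (s : nat -> R) (B : R) N :
  (forall n, (N <= n)%N -> s n <= B) -> exists2 M, 0 <= M & forall n, s n <= M.
Proof.
elim: N B => [|N IH] B sB.
  by exists (Num.max 0 B) => [|n]; rewrite le_max ?lexx // sB ?orbT.
apply: (IH (Num.max B (s N))) => n; rewrite leq_eqVlt => /predU1P[<-|/sB sn].
  by rewrite le_max lexx orbT.
by rewrite le_max sn.
Qed.

Definition power_sum (w : R[i]) (c : nat -> V) n := \sum_(k < n) w ^+ k *: c k.

Lemma power_sum_recr w c n :
  power_sum w c n.+1 = power_sum w c n + w ^+ n *: c n.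
Proof. by rewrite /power_sum big_ord_recr. Qed.

Lemma power_sumS w c n :
  power_sum w c n.+1 = c 0%N + w *: power_sum w (c \o S) n.
Proof.
rewrite /power_sum big_ord_recl expr0 scale1r scaler_sumr; congr (_ + _).
by apply: eq_bigr => i _; rewrite /= scalerA -exprS.
Qed.

(** Convergence at one point w0 bounds |c n| by M |w0|^-n. At t w0 with t small, the terms after c 0
    then add up to at most 2 M t. *)
Lemma power_series_coef0 (c : nat -> V) (r : R) : 0 < r ->
  (forall w : R[i], 0 < rnorm w < r -> null_sequence (power_sum w c)) ->
  c 0%N = 0.
Proof.
move=> r0 null; have r20 : 0 < r / 2 by rewrite divr_gt0.
pose w0 := (r / 2)%:C : R[i].
have nw0 : rnorm w0 = r / 2 by rewrite rnormR gtr0_norm.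
have nullw0 : null_sequence (power_sum w0 c).
  by apply: null; rewrite nw0 r20 ltr_pdivrMr // ltr_pMr // ltr1n.
(* Each term is the difference of two partial sums, eventually of norm at most 1 each. *)
have [M M0 Mc] : exists2 M, 0 <= M & forall n, (r / 2) ^+ n * rnorm (c n) <= M.
  have [N Nle] := nullw0 1 ltr01; apply: (@eventually_bounded _ 2 N) => n Nn.
  have -> : (r / 2) ^+ n * rnorm (c n) = rnorm (power_sum w0 c n.+1 - power_sum w0 c n).
    by rewrite power_sum_recr addrAC subrr add0r rnormZ rnormX nw0.
  by have := Nle n Nn; have := Nle _ (leqW Nn);
    have := rnormB (power_sum w0 c n.+1) (power_sum w0 c n); lra.
apply: rnorm_small => e e0; have e20 : 0 < e / 2 by rewrite divr_gt0.
(* t <= 1 / 2 makes the tail geometric with sum at most 2 M t < e / 2; the other e / 2 is for the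
   partial sum. *)
have [j jM] := geometric_small M e20; pose t := 1 / 2 ^+ j.+1 : R.
have t0 : 0 < t by rewrite divr_gt0 // exprn_gt0.
have t2 : t <= 1 / 2.
  by rewrite /t !mul1r lef_pV2 ?posrE ?exprn_gt0 // exprS ler_peMr // exprn_ege1 // ler1n.
have tM : 2 * M * t < e / 2.
  apply: le_lt_trans jM; rewrite /t exprS le_eqVlt; apply/predU1l.
  by field; rewrite expf_neq0.
pose w := (t * (r / 2))%:C : R[i].
have nw : rnorm w = t * (r / 2) by rewrite rnormR gtr0_norm // mulr_gt0.
have tail n : rnorm (w *: power_sum w (c \o S) n) <= 2 * M * t - 2 * M * t / 2 ^+ n.
  elim: n => [|n IH].
    by rewrite /power_sum big_ord0 scaler0 rnorm0 expr0 divr1 subrr.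
  rewrite power_sum_recr scalerDr scalerA -exprS.
  apply: le_trans (rnormD _ _) _; apply: le_trans (lerD IH (lexx _)) _.
  have -> : rnorm (w ^+ n.+1 *: (c \o S) n) = t ^+ n.+1 * ((r / 2) ^+ n.+1 * rnorm (c n.+1)).
    by rewrite rnormZ rnormX nw exprMn -mulrA.
  have tn : t ^+ n.+1 <= t / 2 ^+ n.
    rewrite exprS ler_pM2l // -exprVn.
    apply: lerXn2r; rewrite ?nnegrE ?invr_ge0 ?(ltW t0) //.
    by rewrite -[2^-1]mul1r.
  have := ler_pM (exprn_ge0 n.+1 (ltW t0)) _ tn (Mc n.+1).
  rewrite mulr_ge0 ?rnorm_ge0 ?exprn_ge0 ?(ltW r20) // => /(_ isT) H.
  apply: le_trans (lerD (lexx _) H) _; rewrite exprS invfM; lra.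
have [|N Nle] := null w _ _ e20.
  rewrite nw mulr_gt0 //=; move: t2 t0 r0; nra.
have := Nle N.+1 (leqnSn N); rewrite power_sumS => cN.
have := tail N; have : 0 <= 2 * M * t / 2 ^+ N.
  by rewrite divr_ge0 ?mulr_ge0 ?exprn_ge0 ?(ltW t0).
have := rnormB (c 0%N + w *: power_sum w (c \o S) N) (w *: power_sum w (c \o S) N).
by rewrite addrK; lra.
Qed.

(** Once the constant coefficient vanishes, the series can be divided by w, which is nonzero on the
    punctured disc. *)
Lemma power_series_coef (c : nat -> V) (r : R) : 0 < r ->
  (forall w : R[i], 0 < rnorm w < r -> null_sequence (power_sum w c)) ->
  forall k, c k = 0.
Proof.
move=> r0 null k; elim: k c null => [|k IH] c null.
  exact: power_series_coef0 r0 null.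
apply: (IH (c \o S)) => w wr; have c0 := power_series_coef0 r0 null.
have w0 : w != 0.
  by apply/eqP => w0; move: wr; rewrite w0 rnorm0 ltxx.
apply: (@null_sequence_eq (fun n => w^-1 *: power_sum w c n.+1) _ 0%N).
  by move=> n _; rewrite power_sumS c0 add0r scalerA mulVf // scale1r.
by apply/null_sequenceZ; apply/(null_sequenceS (power_sum w c)); exact: null.
Qed.

End NullSequences.

Section Drazin.
Variable X : completeNormedModType R[i].
Implicit Types Q B S : X -> X.

Lemma shift_bounded S a : bounded_operator S -> bounded_operator (shift S a).
Proof.
move=> [Sl Sc]; have Ql := linear_shift a Sl; split => //.
apply/(linear_continuous_rnorm Ql).
have [b b0 Sb] := (linear_continuous_rnorm Sl).1 Sc.
exists (b + rnorm a) => [|x]; first by rewrite addr_ge0 ?rnorm_ge0.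
by apply: le_trans (rnormB _ _) _; rewrite rnormZ mulrDl lerD.
Qed.

(* The usual third identity B Q B = B of a Drazin inverse is not needed: the
   coefficient of exponent 0 of the resolvent need not satisfy it. *)
Definition drazin Q := exists d B, [/\ bounded_operator B,
  forall x, B (Q x) = Q (B x) & forall x, iter d.+1 Q (B x) = iter d Q x].

Lemma inverse_drazin Q B : operator_inverse Q B -> drazin Q.
Proof. by move=> [Bb QB BQ]; exists 0%N, B; split=> // x /=; rewrite ?QB ?BQ. Qed.

(* With w = z - a and Q = S - a, comparing coefficients of powers of w in
   (Q - w) (\sum_k w^k A_k) = w^d = (\sum_k w^k A_k) (Q - w) yields
   Q A_k = A_(k-1) + [k = d] and Q A_k = A_k Q. *)
Lemma pole_drazin S a : bounded_operator S -> resolvent_pole S a ->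
  drazin (shift S a).
Proof.
move=> Sb [d [A [r [d0 /gt0_complexE[-> r0] Ab _ Lau]]]].
set rr := complex.Re r in r0 Lau; pose Q := shift S a.
have Qb : bounded_operator Q by exact: shift_bounded.
have [Ql Qc] := Qb; have [q q0 Qq] := (linear_continuous_rnorm Ql).1 Qc.
have Al k : linear (A k) by case: (Ab k).
pose s w n x := \sum_(k < n) w ^+ k *: A k x.
(* The expansion in the variable w = z - a, evaluated at a vector. *)
have laurent w : 0 < rnorm w < rr -> exists B, [/\ operator_inverse (shift S (a + w)) B &
    forall x, null_sequence (fun n => s w n x - w ^+ d *: B x)].
  move=> wr; have [|B [Binv cvB]] := Lau (a + w).
    rewrite addrAC subrr add0r norm_rnormE -(rmorph0 (real_complex R)) !ltcR.
    exact: wr.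
  exists B; split=> // x e e0; have n1 : 0 < rnorm x + 1.
    by rewrite ltr_wpDl // rnorm_ge0.
  have [|N _ Nle] := cvB (e / (rnorm x + 1))%:C; first by rewrite ltcR divr_gt0.
  exists N => n /Nle /(_ x); rewrite !norm_rnormE -rmorphM /= lecR.
  rewrite [a + w]addrC addrK => /le_trans; apply.
  by rewrite mulrAC ler_pdivrMr // ler_wpM2l ?ltW // ltrDl.
have commQ k x : Q (A k x) = A k (Q x).
  apply/eqP; rewrite -subr_eq0; apply/eqP.
  apply: (@power_series_coef _ (fun k => Q (A k x) - A k (Q x)) rr r0) => w wr.
  have [B [[[Bl _] BQ QB] cvB]] := laurent w wr.
  have comm : Q (B x) = B (Q x).
    have QE y : Q y = shift S (a + w) y + w *: y.
      by rewrite /Q /shift scalerDl opprD addrA subrK.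
    by rewrite [Q (B x)]QE QB [Q x]QE (linear_D Bl) (linear_Z Bl) BQ.
  apply: (@null_sequence_eq _ (fun n => Q (s w n x - w ^+ d *: B x) -
      (s w n (Q x) - w ^+ d *: B (Q x))) _ 0%N) => [n _|].
    rewrite (linear_B Ql) (linear_Z Ql) comm opprB addrA subrK.
    rewrite /s (linear_sum Ql (fun k => w ^+ k *: A k x)) -sumrB.
    by apply: eq_bigr => i _; rewrite (linear_Z Ql) [RHS]scalerBr.
  by apply: null_sequenceB; [exact: (null_sequence_bounded q0 Qq)|exact: cvB].
(* The match sets A_(-1) to 0. *)
have recQ k x : Q (A k x) = (if k is k'.+1 then A k' x else 0) + (if k == d then x else 0).
  apply/eqP; rewrite -subr_eq0; apply/eqP.
  apply: (@power_series_coef _ (fun k => Q (A k x) -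
    ((if k is k'.+1 then A k' x else 0) + (if k == d then x else 0))) rr r0) => w wr.
  have [B [[_ BQ QB] cvB]] := laurent w wr.
  (* Partial sums with n + 1 terms absorb the index shift caused by multiplication by w; from n = d
     on they also contain the term w^d x. *)
  apply/null_sequenceS.
  apply: (@null_sequence_eq _ (fun n => Q (s w n.+1 x - w ^+ d *: B x) -
      w *: (s w n x - w ^+ d *: B x)) _ d) => [n dn|]; last first.
    apply: null_sequenceB; last exact/null_sequenceZ/cvB.
    apply: (null_sequence_bounded q0 Qq).
    exact/(null_sequenceS (fun n => s w n x - w ^+ d *: B x))/cvB.
  transitivity (\sum_(i < n.+1) w ^+ i *: Q (A i x) -
     (\sum_(i < n.+1) w ^+ i *: (if val i is k'.+1 then A k' x else 0) +
      \sum_(i < n.+1) w ^+ i *: (if val i == d then x else 0))); last first.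
    rewrite -big_split -sumrB; apply: eq_bigr => i _.
    by rewrite /= -scalerDr -scalerBr.
  have -> : \sum_(i < n.+1) w ^+ i *: (if val i == d then x else 0) = w ^+ d *: x.
    rewrite (bigD1 (Ordinal (dn : d < n.+1)%N)) //= eqxx big1 ?addr0 // => i.
    by rewrite -val_eqE /= => /negbTE ->; rewrite scaler0.
  have -> : \sum_(i < n.+1) w ^+ i *: (if val i is k'.+1 then A k' x else 0) = w *: s w n x.
    rewrite big_ord_recl scaler0 add0r scaler_sumr; apply: eq_bigr => i _.
    by rewrite scalerA -exprS.
  have -> : \sum_(i < n.+1) w ^+ i *: Q (A i x) = Q (s w n.+1 x).
    rewrite /s (linear_sum Ql (fun k => w ^+ k *: A k x)).
    by apply: eq_bigr => i _; rewrite (linear_Z Ql).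
  have QBx : Q (B x) = x + w *: B x.
    by rewrite -[X in X + _]QB /Q /shift scalerDl opprD addrA subrK.
  rewrite (linear_B Ql) (linear_Z Ql) QBx scalerBr scalerDr !scalerA mulrC.
  by rewrite !opprD opprK !addrA [in LHS]addrAC subrK addrAC.
exists d, (A d); split=> [//|x|x]; first exact/esym/commQ.
(* Q lowers the index of A_k and kills A_0. So Q^d A_(d-1) = 0, and Q^(d+1) A_d = Q^d (A_(d-1) + I)
   = Q^d. *)
have nilA k : (k < d)%N -> iter k.+1 Q (A k x) = 0.
  elim: k => [|k IH] kd; first by rewrite /= recQ (ltn_eqF kd) addr0.
  by rewrite iterSr recQ (ltn_eqF kd) addr0 IH // ltnW.
rewrite -/Q iterSr recQ eqxx; case: d d0 {Ab Lau laurent recQ s} nilA => // d _ nilA.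
by rewrite (linear_D (linear_iter _ Ql)) nilA // add0r.
Qed.

(** The Fitting decomposition X = N(Q^d) + R(Q^d), with Q invertible on the closed range and C
    bounding the inverse there. Elements of R(Q^d) appear as [iter d Q y]; directness of the sum
    follows from injectivity on the range. *)
Definition fitting Q := exists d (C : R), [/\ 0 <= C, closed (range (iter d Q)),
  forall y, exists u v, y = u + iter d Q v /\ iter d Q u = 0,
  forall y, Q (iter d Q y) = 0 -> iter d Q y = 0 &
  forall y, exists y', Q (iter d Q y') = iter d Q y /\
    rnorm (iter d Q y') <= C * rnorm (iter d Q y)].

(** Iterating the hypothesis gives Q^d = Q^(d+j) B^j. For j = d, Q^d B^d y is the range component of
    y and B^d Q^d y a bounded lift of Q^d y. On R(Q^d), B inverts Q. *)
Lemma drazin_fitting Q : bounded_operator Q -> drazin Q -> fitting Q.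
Proof.
move=> [Ql Qc] [d [B [[Bl Bc] comm QB]]].
have [q q0 Qq] := (linear_continuous_rnorm Ql).1 Qc.
have [b b0 Bb] := (linear_continuous_rnorm Bl).1 Bc.
have commn m y : B (iter m Q y) = iter m Q (B y).
  by elim: m => //= m IH; rewrite comm IH.
have commi n m y : iter n B (iter m Q y) = iter m Q (iter n B y).
  by elim: n => //= n ->; rewrite commn.
have QjBj j y : iter d Q (iter j Q (iter j B y)) = iter d Q y.
  elim: j => // j IH; rewrite -{}IH; set z := iter j B y.
  rewrite [iter j.+1 B y]/= -/z -iterD addnS -addSn addnC iterD QB -!iterD.
  by rewrite addnC.
have Qdl := linear_iter d Ql.
exists d, b; split=> //.
- apply: liftable_closed_image => //.
    apply/(linear_continuous_rnorm Qdl).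
    by exists (q ^+ d); [exact: exprn_ge0|exact: bounded_iter].
  exists (b ^+ d); first exact: exprn_ge0.
  move=> y _; exists (iter d B (iter d Q y)); split=> //; last exact: bounded_iter.
  by rewrite commi QjBj.
- move=> y; exists (y - iter d Q (iter d B y)), (iter d B y).
  by rewrite subrK (linear_B Qdl) QjBj subrr.
- by move=> y Qy; rewrite -QB -commn /= Qy (linear_0 Bl).
- by move=> y; exists (B y); rewrite -iterS QB -commn.
Qed.

End Drazin.
End Pole.

(** * Splitting off a pole *)

Section Decomposition.
Variables (R : realType) (X : completeNormedModType R[i]).

(** The open mapping theorem for addition on M x N with the maximum norm; uniqueness of the
    decomposition identifies the bounded lift with the given pair. *)
Lemma direct_sum_bound (M N : closed_subspace X) : direct_sum M N ->
  exists2 P : R, 0 <= P & forall y z, (M : set X) y -> (N : set X) z ->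
    rnorm y <= P * rnorm (y + z) /\ rnorm z <= P * rnorm (y + z).
Proof.
move=> [MN0 MN]; have Ms := closed_subspaceP M; have Ns := closed_subspaceP N.
have [M0 MD MZ] := Ms; have [N0 ND NZ] := Ns.
pose D : set (X * X) := [set p | (M : set X) p.1 /\ (N : set X) p.2].
pose nV (p : X * X) : R := Num.max (rnorm p.1) (rnorm p.2).
pose S (p : X * X) : X := p.1 + p.2.
have Sl : linear S by move=> a x y; rewrite /S /= scalerDr addrACA.
have image_S : S @` D = setT.
  apply/seteqP; split=> // x _; have [y [z [My Nz ->]]] := MN x.
  by exists (y, z).
have complete_D : geometric_complete D nV.
  move=> x c Dx xc.
  have [||s1 Ms1 s1le] := subspace_geometric_complete Ms (@subspace_closed _ _ M)
    (x := fun k => (x k).1) (c := c).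
  - by move=> k; have [] := Dx k.
  - by move=> k; apply: le_trans (xc k); rewrite /nV le_max lexx.
  have [||s2 Ns2 s2le] := subspace_geometric_complete Ns (@subspace_closed _ _ N)
    (x := fun k => (x k).2) (c := c).
  - by move=> k; have [] := Dx k.
  - by move=> k; apply: le_trans (xc k); rewrite /nV le_max lexx orbT.
  exists (s1, s2) => // k; rewrite /nV ge_max; apply/andP; split => /=.
  - by rewrite (raddf_sum fst); exact: s1le.
  - by rewrite (raddf_sum snd); exact: s2le.
have [|||||||||P P0 lift] := open_mapping (b := 2) complete_D _ _ _ _ _ _ Sl.
- by move=> a p [Mp Np]; split; [exact: MZ|exact: NZ].
- by move=> p q [Mp Np] [Mq Nq]; split; exact: is_subspaceB.
- by move=> a p; rewrite /nV /= !rnormZ maxr_pMr ?rnorm_ge0.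
- move=> p q; rewrite /nV ge_max; apply/andP; split.
    by apply: le_trans (rnormB _ _) _; rewrite lerD // le_max lexx.
  by apply: le_trans (rnormB _ _) _; rewrite lerD // le_max lexx orbT.
- by move=> p; rewrite /nV le_max rnorm_ge0.
- by [].
- by [].
- move=> p; apply: le_trans (rnormD _ _) _; rewrite mulr_natl mulr2n.
  by rewrite lerD // /nV le_max lexx ?orbT.
- by rewrite image_S; exact: closedT.
exists P => // y z My Nz.
have [|[y' z'] [[/= My' Nz'] yz' ple]] := lift (y, z); first by [].
have E : y' - y = z - z'.
  by rewrite -[y'](addrK z') (yz' : y' + z' = y + z) addrAC [y + z]addrC addrK.
have : (M `&` N) (y' - y) by split; [|rewrite E]; exact: is_subspaceB.
rewrite MN0 => /= y'y; have {}y'y : y' = y by apply/subr0_eq.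
have z'z : z' = z by apply/esym/subr0_eq; rewrite -E y'y subrr.
by move: ple; rewrite /nV /S /= y'y z'z ge_max => /andP.
Qed.

Section Assembly.
Variables (Q : X -> X) (M N : closed_subspace X).
Variables (QM : invariant Q M) (QN : invariant Q N).
Hypotheses (Q_bounded : bounded_operator Q) (MN : direct_sum M N).

Lemma kato_fitting_kato_type :
  kato_on Q M -> fitting (restriction QN) -> kato_type Q.
Proof.
move=> [[C1 C10 liftM] kerM] [d [C [C0 cl dec inj lift]]].
set r := restriction QN in cl dec inj lift.
have [Ql Qc] := Q_bounded; have [q q0 Qq] := (linear_continuous_rnorm Ql).1 Qc.
have rl : linear r by case: (restriction_bounded QN Q_bounded).
have Qdl := linear_iter d Ql; have rdl := linear_iter d rl.
have [P P0 proj] := direct_sum_bound MN.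
have Ms := closed_subspaceP M; have Ns := closed_subspaceP N.
have [M0 MD MZ] := Ms; have [N0 ND NZ] := Ns.
have val_r u : val (r u) = Q (val u) by exact: val_restriction.
have disjointMN x : (M : set X) x -> (N : set X) x -> x = 0.
  by case: MN => MN0 _ Mx Nx; have : (M `&` N) x by []; rewrite MN0.
(* X is split as (M + R(Q_N^d)) + N(Q_N^d). *)
pose N2 : set X := [set x | exists u : subspace_type N, x = val (iter d r u)].
pose N1 : set X := [set x | (N : set X) x /\ iter d Q x = 0].
pose M' : set X := [set x | exists m n, [/\ (M : set X) m, N2 n & x = m + n]].
have N2N x : N2 x -> (N : set X) x by move=> [u ->]; exact: subspace_valP.
have N2_0 : N2 0 by exists 0; rewrite (linear_0 rdl) raddf0.
have N2_closed x : (N : set X) x ->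
    (forall e : R, 0 < e -> exists2 y, N2 y & rnorm (x - y) < e) -> N2 x.
  move=> /subspace_lift[u <-] approx; have [|v _ <-] := (closed_rnormP _).1 cl u; last by exists v.
  move=> e /approx[_ [v ->] uv]; exists (iter d r v); first by exists v.
  by rewrite -rnorm_val raddfB.
have M's : is_subspace M'.
  split.
  - by exists 0, 0; rewrite addr0.
  - move=> _ _ [m [_ [Mm [u ->] ->]]] [m2 [_ [Mm2 [u2 ->] ->]]].
    exists (m + m2), (val (iter d r (u + u2))); split; [exact: MD|by exists (u + u2)|].
    by rewrite (linear_D rdl) raddfD addrACA.
  - move=> a _ [m [_ [Mm [u ->] ->]]].
    exists (a *: m), (val (iter d r (a *: u))); split; [exact: MZ|by exists (a *: u)|].
    by rewrite (linear_Z rdl) linearZ scalerDr.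
have N1s : is_subspace N1.
  split.
  - by split; rewrite ?(linear_0 Qdl).
  - by move=> x y [Nx Qx] [Ny Qy]; split; [exact: ND|rewrite (linear_D Qdl) Qx Qy addr0].
  - by move=> a x [Nx Qx]; split; [exact: NZ|rewrite (linear_Z Qdl) Qx scaler0].
have M'cl : closed M'.
  apply/closed_rnormP => x approx; have [m [n [Mm Nn xmn]]] := MN.2 x.
  exists m, n; split=> //; apply: N2_closed => // e e0; have P1 : 0 < P + 1 by rewrite ltr_wpDl.
  have [|_ [m' [n' [Mm' N2n' ->]]]] := approx (e / (P + 1)); first by rewrite divr_gt0.
  rewrite ltr_pdivlMr // => close; exists n' => //.
  (* The projection bound makes the components of the approximants in [N] approach [n]. *)
  have [_ nle] := proj (m - m') (n - n') (is_subspaceB Ms Mm Mm') (is_subspaceB Ns Nn (N2N _ N2n')).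
  apply: le_lt_trans nle _; apply: le_lt_trans close.
  by rewrite xmn opprD addrACA mulrC ler_wpM2l ?rnorm_ge0 // lerDl.
have N1cl : closed N1.
  apply/closed_rnormP => x approx; split.
    apply: ((closed_rnormP _).1 (@subspace_closed _ _ N)) => e /approx[y [Ny _] xy].
    by exists y.
  apply: rnorm_small => e e0; have qd0 : 0 < q ^+ d + 1 by rewrite ltr_wpDl // exprn_ge0.
  have [|y [_ Qy]] := approx (e / (q ^+ d + 1)); first by rewrite divr_gt0.
  rewrite ltr_pdivlMr // => /ltW xy.
  have -> : iter d Q x = iter d Q (x - y) by rewrite (linear_B Qdl) Qy subr0.
  apply: le_trans (bounded_iter _ q0 Qq _) _; apply: le_trans xy.
  by rewrite mulrC ler_wpM2l ?rnorm_ge0 // lerDl.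
pose Mc := ClosedSubspace (subspace_submod_closed M's) M'cl.
pose Nc := ClosedSubspace (subspace_submod_closed N1s) N1cl.
have QMc : invariant Q Mc.
  move=> _ [m [_ [Mm [u ->] ->]]]; exists (Q m), (val (iter d r (r u))).
  split; [exact: QM|by exists (r u)|].
  by rewrite (linear_D Ql) -val_r -iterS iterSr.
have QNc : invariant Q Nc.
  move=> x [Nx Qx]; split; first exact: QN.
  by rewrite -iterSr iterS Qx (linear_0 Ql).
exists Mc, Nc, QMc, QNc; split.
- split; last first.
    move=> x; have [y [_ [My /subspace_lift[z <-] ->]]] := MN.2 x.
    have [u [v [-> Qu]]] := dec z; exists (y + val (iter d r v)), (val u).
    split; last by rewrite raddfD addrAC addrA.
    + by exists y, (val (iter d r v)); split=> //; exists v.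
    + by split; [exact: subspace_valP|rewrite -(val_iter_restriction QN) Qu raddf0].
  apply/seteqP; split=> [x|_ ->]; last by split; [case: (M's)|case: (N1s)].
  (* m = x - n lies in both [M] and [N], so it vanishes. Then n is in the range and the kernel of
     Q_N^d, and injectivity on the range is used d times. *)
  move=> [[m [n [Mm [u nu] xmn]]] [Nx Qx]] /=.
  have m0 : m = 0.
    apply: disjointMN => //; have -> : m = x - n by rewrite xmn addrK.
    by apply: is_subspaceB => //; apply: N2N; exists u.
  move: Qx; rewrite xmn m0 add0r nu -(val_iter_restriction QN) -/r => Qx.
  have {}Qx : iter d r (iter d r u) = 0 by apply: val_inj; rewrite Qx raddf0.
  suff -> : iter d r u = 0 by rewrite raddf0.
  have peel j : iter j r (iter d r u) = 0 -> iter d r u = 0.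
    elim: j => // j IH; rewrite -iterD addSn addnC /= iterD => /inj.
    by rewrite -iterD addnC iterD; exact: IH.
  exact: peel Qx.
- apply/(kato_restriction QMc Q_bounded); split.
    (* Each summand is lifted separately, with constants C1 and C; P bounds both images by the norm
       of their sum. *)
    exists ((C1 + C) * P); first by rewrite mulr_ge0 // addr_ge0.
    move=> _ [m [_ [Mm [u ->] ->]]]; have [m' [Mm' Qm' m'le]] := liftM m Mm.
    have [y' [ry' y'le]] := lift (r u).
    exists (m' + val (iter d r y')); split.
    + by exists m', (val (iter d r y')); split=> //; exists y'.
    + by rewrite !(linear_D Ql) Qm' -!val_r ry' -iterSr.
    rewrite (linear_D Ql) -val_r -[r (iter d r u)]iterS iterSr.
    have [Qmle Qnle] := proj (Q m) (val (iter d r (r u))) (QM Mm) (subspace_valP _).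
    apply: le_trans (rnormD _ _) _; rewrite -mulrA mulrDl lerD //.
    + by apply: le_trans m'le _; rewrite ler_wpM2l.
    + by apply: le_trans y'le _; rewrite ler_wpM2l.
  (* Both components of Q x vanish; injectivity on the range removes the second component of x, and
     the Kato property on [M] handles the first. *)
  move=> k _ [m [_ [Mm [u ->] ->]]]; rewrite (linear_D Ql) -val_r => Qx.
  have [] := proj (Q m) (val (r (iter d r u))) (QM Mm) (subspace_valP _).
  rewrite Qx rnorm0 mulr0 => Qm Qn.
  have {}Qm : Q m = 0 by apply/rnorm0_eq0/eqP; rewrite eq_le Qm rnorm_ge0.
  have {}Qn : r (iter d r u) = 0.
    by apply/rnorm0_eq0/eqP; rewrite eq_le Qn rnorm_ge0.
  have [y My <-] := kerM k m Mm Qm; rewrite (inj _ Qn) raddf0 addr0.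
  by exists y => //; exists y, 0; rewrite addr0.
- exists d => x; apply: val_inj; rewrite val_iter_restriction raddf0.
  by have [_] := subspace_valP x.
Qed.

End Assembly.

Lemma invariant_shift (T : X -> X) (M : closed_subspace X) a :
  invariant T M -> invariant (shift T a) M.
Proof.
move=> TM x Mx; have [M0 MD MZ] := closed_subspaceP M.
by apply: (is_subspaceB (closed_subspaceP M)); [exact: TM|exact: MZ].
Qed.

Lemma restriction_shift (T : X -> X) (M : closed_subspace X) a
    (TM : invariant T M) (TaM : invariant (shift T a) M) :
  restriction TaM = shift (restriction TM) a.
Proof.
apply: funext => x; apply: val_inj.
rewrite [LHS]val_restriction /shift -(val_restriction TM).
have <- : \val (a *: x) = a *: \val x by rewrite linearZ.
by rewrite -(raddfB (\val : subspace_type M -> X)).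
Qed.

(** The radius comes from [M] alone: on [N], every nonzero [a] is a regular point or a pole,
    whatever its size. *)
Lemma gk_meromorphic_punctured (T : X -> X) : bounded_operator T ->
  gk_meromorphic T -> exists2 e : R, 0 < e &
    forall a, 0 < rnorm a < e -> kato_type (shift T a).
Proof.
move=> Tb [M [N [TM [TN [MN TMk TNm]]]]].
have TMb := restriction_bounded TM Tb; have TNb := restriction_bounded TN Tb.
have [e e0 eK] := kato_shift TMb ((kato_onT TMb).1 TMk).
exists e => // a /andP[a0 ae].
have QM := invariant_shift a TM; have QN := invariant_shift a TN.
have Qb := shift_bounded a Tb.
apply: (@kato_fitting_kato_type _ M N QM QN Qb MN).
  apply/(kato_restriction QM Qb); rewrite (restriction_shift TM).
  by apply/(kato_onT (shift_bounded a TMb)); exact: eK.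
rewrite (restriction_shift TN); apply: drazin_fitting; first exact: shift_bounded.
have [sp|] := pselect (spectrum (restriction TN) a).
  apply: (pole_drazin TNb); apply: TNm => // a00.
  by move: a0; rewrite a00 rnorm0 ltxx.
by move=> /contrapT[B]; exact: inverse_drazin.
Qed.

End Decomposition.

(** * Subsets of the complex plane *)

Section ComplexPlane.
Variable R : realType.
Local Notation K := (R[i] : numFieldType).

Lemma rnorm_complex_le (x y : R) : rnorm (x +i* y : R[i]) <= `|x| + `|y|.
Proof.
have -> : x +i* y = x%:C + 'i%C * y%:C by rewrite [LHS]complexE.
apply: le_trans (rnormD _ _) _; rewrite rnormM !rnormR.
have -> : rnorm ('i%C : R[i]) = 1.
  by rewrite /rnorm normc_def /= expr0n add0r expr1n sqrtr1.
by rewrite mul1r.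
Qed.

Lemma Re_le_rnorm (z : R[i]) : `|complex.Re z| <= rnorm z.
Proof. by rewrite -lecR -norm_rnormE normc_ge_Re. Qed.

Lemma Im_le_rnorm (z : R[i]) : `|complex.Im z| <= rnorm z.
Proof.
rewrite /rnorm normc_def /= -sqrtr_sqr ler_wsqrtr // lerDr sqr_ge0 //.
Qed.

(** The set is closed in the continuous image of the compact square [-b, b]^2. *)
Lemma closed_bounded_compact (A : set K) (b : R) : closed A ->
  (forall z : K, A z -> rnorm (z : R[i]) <= b) -> compact A.
Proof.
move=> Acl Ab; pose f (p : R * R) : K := p.1 +i* p.2.
pose B := f @` (`[- b, b] `*` `[- b, b]).
have fc : continuous f.
  move=> p; apply/cvgrPdist_lt => e /gt0_complexE[-> e0].
  set d := complex.Re e in e0 *; have d20 : 0 < d / 2 by rewrite divr_gt0.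
  exists (ball p.1 (d / 2), ball p.2 (d / 2)) => /= [|q [/=]].
    by split; exact: nbhsx_ballx.
  rewrite -!ball_normE /= => pq1 pq2; rewrite (norm_rnormE (f p - f q : R[i])) ltcR.
  have -> : f p - f q = (p.1 - q.1) +i* (p.2 - q.2) :> R[i] by [].
  have := ltrD pq1 pq2; rewrite -splitr; exact/le_lt_trans/rnorm_complex_le.
apply: (@subclosed_compact _ A B Acl).
  apply: continuous_compact; first exact: continuous_subspaceT.
  by apply: compact_setX; exact: segment_compact.
move=> z /Ab zb; exists (complex.Re z, complex.Im z); last by rewrite /f; case: z {zb}.
split; rewrite /= in_itv /= -ler_norml.
- exact: le_trans (Re_le_rnorm _) zb.
- exact: le_trans (Im_le_rnorm _) zb.
Qed.

(** A point is coded by an n such that radius 2^-n isolates it, and by rational approximations of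
    its coordinates within a quarter of that radius. Points with the same code are closer than the
    radius, hence equal. *)
Lemma isolated_countable (A : set R[i]) :
  (forall x, A x -> exists2 e : R, 0 < e & forall y, A y -> rnorm (y - x) < e -> y = x) ->
  countable A.
Proof.
move=> isol.
have approx (x d : R) : 0 < d -> exists q : rat, `|x - ratr q| < d.
  move=> d0; have [|q] := @rat_in_itvoo _ (x - d) (x + d).
    by rewrite ltrBlDr -addrA ltrDl addr_gt0.
  rewrite in_itv /= => /andP[q1 q2]; exists q; rewrite ltr_norml; lra.
have /choice[code codeP] (x : R[i]) : exists c : nat * rat * rat, A x ->
    [/\ forall y, A y -> rnorm (y - x) < 1 / 2 ^+ c.1.1 -> y = x,
    `|complex.Re x - ratr c.1.2| < 1 / 2 ^+ c.1.1 / 4 &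
    `|complex.Im x - ratr c.2| < 1 / 2 ^+ c.1.1 / 4].
  have [/isol[e e0 xe]|nAx] := pselect (A x); last by exists (0%N, 0, 0).
  have [n ne] := geometric_small 1 e0.
  have d0 : 0 < 1 / 2 ^+ n / 4 :> R by rewrite !divr_gt0 // exprn_gt0.
  have [p xp] := approx (complex.Re x) _ d0; have [q xq] := approx (complex.Im x) _ d0.
  by exists (n, p, q) => _; split=> // y Ay yx; apply: xe => //; exact: lt_trans yx ne.
apply/countable_injP; exists (pickle \o code) => x y /set_mem Ax /set_mem Ay.
move=> /(pcan_inj pickleK) cxy.
have [yx xp xq] := codeP x Ax; have [_ yp yq] := codeP y Ay.
apply/esym/yx => //; rewrite -cxy in yp yq.
set d := 1 / 2 ^+ _ in xp xq yp yq *; have d0 : 0 < d by rewrite divr_gt0 // exprn_gt0.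
have -> : y - x = (complex.Re y - complex.Re x) +i* (complex.Im y - complex.Im x).
  by case: y {Ay cxy yp yq yx}; case: x {Ax xp xq d d0}.
apply: le_lt_trans (rnorm_complex_le _ _) _.
have H (u v w : R) : `|u - w| < d / 4 -> `|v - w| < d / 4 -> `|v - u| < d / 2.
  by rewrite !ltr_norml => /andP[? ?] /andP[? ?]; apply/andP; split; lra.
by rewrite (splitr d) ltrD //; [exact: H xp yp|exact: H xq yq].
Qed.

End ComplexPlane.

(** * Invertibility of scalar shifts of nilpotent operators *)

Section Spectra.
Variables (R : realType) (X : completeNormedModType R[i]).

(** The Neumann series is finite: the inverse of S - a is minus the sum of a^-(k+1) S^k over k <
    n. *)
Lemma nilpotent_shift_inverse (S : X -> X) (a : R[i]) :
  bounded_operator S -> nilpotent S -> a != 0 ->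
  exists B, operator_inverse (shift S a) B.
Proof.
move=> [Sl Sc] [n Sn] a0; have [b b0 Sb] := (linear_continuous_rnorm Sl).1 Sc.
pose B (x : X) := - \sum_(k < n) a ^- k.+1 *: iter k S x.
have Bl : linear B.
  move=> c x y; rewrite /B scalerN -opprD scaler_sumr -big_split; congr (- _).
  by apply: eq_bigr => i _; rewrite /= (linear_iter _ Sl) scalerDr !scalerA mulrC.
have Bb : bounded_operator B.
  split=> //; apply/(linear_continuous_rnorm Bl).
  exists (\sum_(k < n) rnorm (a ^- k.+1) * b ^+ k).
    by apply: sumr_ge0 => i _; rewrite mulr_ge0 ?rnorm_ge0 ?exprn_ge0.
  move=> x; rewrite /B rnormN mulr_suml.
  elim/big_ind2: _ => [|u s v t us vt|i _]; first by rewrite rnorm0.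
    by apply: le_trans (rnormD _ _) _; rewrite lerD.
  by rewrite rnormZ -mulrA ler_wpM2l ?rnorm_ge0 // bounded_iter.
have BS x : B (S x) = S (B x).
  rewrite /B (linear_N Sl) (linear_sum Sl (fun k => a ^- k.+1 *: iter k S x)).
  by congr (- _); apply: eq_bigr => i _; rewrite (linear_Z Sl) -iterSr.
(* The sum telescopes, with end terms f 0 = x and f n = 0. *)
have SB x : S (B x) - a *: B x = x.
  pose f k := a ^- k *: iter k S x.
  transitivity (- \sum_(0 <= k < n) (f k.+1 - f k)).
    have -> : S (B x) = - \sum_(k < n) f k.+1.
      rewrite /B (linear_N Sl) (linear_sum Sl (fun k => a ^- k.+1 *: iter k S x)).
      by congr (- _); apply: eq_bigr => i _; rewrite (linear_Z Sl).
    have -> : a *: B x = - \sum_(k < n) f k.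
      rewrite /B scalerN scaler_sumr; congr (- _); apply: eq_bigr => i _.
      by rewrite scalerA exprS invfM mulrA mulfV // mul1r.
    by rewrite big_mkord sumrB opprB opprK addrC.
  by rewrite telescope_sumr // /f Sn scaler0 sub0r opprK expr0 invr1 scale1r.
exists B; split=> // x.
by rewrite /shift (linear_B Bl) (linear_Z Bl) BS SB.
Qed.

End Spectra.

(** * Kato type operators and the two spectra *)

Section Corollary.
Variables (R : realType) (X : completeNormedModType R[i]).

(** A nilpotent operator has no nonzero spectrum, so it is vacuously meromorphic. *)
Lemma kato_type_gk_meromorphic (T : X -> X) : bounded_operator T ->
  kato_type T -> gk_meromorphic T.
Proof.
move=> Tb [M [N [TM [TN [MN TMk TNn]]]]]; exists M, N, TM, TN; split=> // a spa a0.
case: spa; apply: nilpotent_shift_inverse TNn _; first exact: restriction_bounded.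
exact/eqP.
Qed.

(** The second summand is the zero subspace, on which already T^0 vanishes. *)
Lemma kato_kato_type (T : X -> X) : bounded_operator T ->
  kato_on T setT -> kato_type T.
Proof.
move=> Tb Tk; have Tl := Tb.1.
have s0 : is_subspace [set 0 : X].
  by split=> [//|x y -> ->|a x ->] /=; rewrite ?addr0 ?scaler0.
have cl0 : closed [set 0 : X].
  apply/closed_rnormP => x approx; apply: rnorm_small => e /approx[_ -> ].
  by rewrite subr0 => /ltW.
pose M := ClosedSubspace (subspace_submod_closed (@is_subspaceT _ X)) closedT.
pose N := ClosedSubspace (subspace_submod_closed s0) cl0.
have TM : invariant T M by [].
have TN : invariant T N by move=> x ->; exact: linear_0.
exists M, N, TM, TN; split.
- split; first by rewrite setTI.
  by move=> x; exists x, 0; rewrite addr0.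
- exact/(kato_restriction TM Tb).
- by exists 0%N => x; apply: val_inj; rewrite raddf0; exact: (subspace_valP x).
Qed.

(** Let b bound [T] and |a| > 2 b. Then x = - a^-1 z solves (T - a) x = z up to a^-1 T z, at most
    half of z in norm, so T - a is onto with bounded lifts. A kernel vector satisfies |a| |x| <= b
    |x|, so it is 0. *)
Lemma kato_type_large (T : X -> X) : bounded_operator T ->
  exists b : R, forall a, b < rnorm a -> kato_type (shift T a).
Proof.
move=> Tb; have [Tl Tc] := Tb; have [b b0 Tle] := (linear_continuous_rnorm Tl).1 Tc.
exists (2 * b) => a ba; have Sb := shift_bounded a Tb; have Sl := Sb.1.
have na : 0 < rnorm a by apply: le_lt_trans ba; rewrite mulr_ge0.
have a0 : a != 0 by apply/eqP => a0; move: na; rewrite a0 rnorm0 ltxx.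
have [c c0 Sc] := (linear_continuous_rnorm Sl).1 Sb.2.
apply: kato_kato_type => //; split.
  have C0 : 0 <= (rnorm a)^-1 by rewrite invr_ge0 ltW.
  exists (2 * (rnorm a)^-1) => [|y _]; first by rewrite mulr_ge0.
  apply: (approximate_lift (W := setT) _ _ c0 Sc C0) => //.
  - exact: subspace_geometric_complete (@is_subspaceT _ X) closedT.
  - exact: linear_B.
  move=> z _; exists (- (a^-1 *: z)); split=> //.
    by rewrite rnormN rnormZ rnormV.
  have -> : z - shift T a (- (a^-1 *: z)) = a^-1 *: T z.
    rewrite /shift (linear_N Tl) (linear_Z Tl) scalerN scalerA mulfV // scale1r.
    by rewrite opprK opprD opprK addrCA subrr addr0.
  rewrite rnormZ rnormV ler_pdivlMr // mulrC mulrA -ler_pdivlMl ?mulr_gt0 ?invr_gt0 //.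
  by apply: le_trans (Tle _) _; rewrite invfM invrK; have := ler_wpM2r (rnorm_ge0 z) (ltW ba); lra.
move=> n x _ Sx; exists 0 => //; rewrite (linear_0 (linear_iter n Sl)).
have Tx : T x = a *: x by apply/subr0_eq.
apply/esym/rnorm0_eq0/eqP; rewrite eq_le rnorm_ge0 andbT leNgt; apply/negP => nx.
have := Tle x; rewrite Tx rnormZ ler_pM2r //; move: ba b0; lra.
Qed.

Lemma shift_shift (T : X -> X) a c : shift (shift T a) c = shift T (a + c).
Proof. by apply: funext => x; rewrite /shift scalerDl opprD addrA. Qed.

Lemma kato_type_punctured (T : X -> X) (a : R[i]) : bounded_operator T ->
  gk_meromorphic (shift T a) -> exists2 e : R, 0 < e &
    forall c : R[i], 0 < rnorm (c - a) < e -> kato_type (shift T c).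
Proof.
move=> Tb /(gk_meromorphic_punctured (shift_bounded a Tb))[e e0 eK].
by exists e => // c /eK; rewrite shift_shift addrC subrK.
Qed.

End Corollary.

Theorem corollary3p1 (R : realType) (X : completeNormedModType R[i])
    (X_infinite : infinite_dimensional X)
    (T : X -> X) (T_bounded : bounded_operator T) :
  compact (gk_meromorphic_spectrum T) /\
  countable (kato_type_spectrum T `\` gk_meromorphic_spectrum T).
Proof.
have kato_gk a : kato_type (shift T a) -> gk_meromorphic (shift T a).
  exact/kato_type_gk_meromorphic/shift_bounded.
split.
  have [b large] := kato_type_large T_bounded.
  apply: (@closed_bounded_compact R _ b).
    apply/(closed_rnormP (V := (R[i] : numFieldType))) => a approx gk.
    have [e e0 near_a] := kato_type_punctured T_bounded gk.
    have [c gkc ac] := approx e e0; apply: gkc.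
    (* A point [c] near [a] is either [a] itself, where a decomposition is assumed, or of Kato type;
       in both cases it is outside the spectrum. *)
    have [->//|/eqP ca] := eqVneq c a; apply: kato_gk; apply: near_a.
    by rewrite -rnormBC ac andbT; apply: rnorm_gt0 => /subr0_eq /esym.
  move=> a gka; rewrite leNgt; apply/negP => ba.
  by apply: gka; apply: kato_gk; exact: large.
(* At such an [a] a decomposition exists, so all other nearby points are of Kato type and outside
   the difference. *)
apply: isolated_countable => a [_ /contrapT gk].
have [e e0 near_a] := kato_type_punctured T_bounded gk.
exists e => // c [katoc _] ca; apply: contrapT => neq; apply: katoc; apply: near_a.
by rewrite ca andbT; apply: rnorm_gt0 => /subr0_eq.
Qed.
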